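(* Let $N\ge1$, $d\ge1$, let $\mathbf p_1,\dots,\mathbf p_N$ be fixed points in $\mathbb R^d$, let $K$ be their convex hull, and for $r>0$ let $B_i=B^d(\mathbf p_i,r)$. Then, as $r\to\infty$, $$\mathrm{vol}_d\Big(\bigcup_{i=1}^NB_i\Big)=\kappa_dr^d+\kappa_{d-1}V_1(K)r^{d-1}+\kappa_{d-2}V_2(K)r^{d-2}+O(r^{d-3}).$$
   Context: $\mathrm{vol}_d$ is $d$-dimensional volume, $\kappa_n$ is the volume of the unit ball of $\mathbb R^n$ ($\kappa_0=1$), $B^d(\mathbf x,r)$ is the closed ball of radius $r$ about $\mathbf x$. The intrinsic volumes $V_k(K)$ of a nonempty compact convex set $K\subset\mathbb R^d$ are defined by Steiner's formula $\mathrm{vol}_d(K+B^d(\mathbf 0,r))=\sum_{k=0}^d\kappa_{d-k}V_k(K)r^{d-k}$ for $r\ge 0$; $V_k(K)=0$ for $k>d$. If $d=1$, the term $\kappa_{d-2}V_2(K)r^{d-2}$ is read as $0$. *)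

(* Defs.v *)
From HB Require Import structures.
From mathcomp Require Import all_boot all_order all_algebra.
From mathcomp Require Import all_classical all_reals all_analysis.

Set Implicit Arguments.
Unset Strict Implicit.
Unset Printing Implicit Defensive.

Import Order.TTheory GRing.Theory Num.Theory.
Import numFieldNormedType.Exports.

Local Open Scope classical_set_scope.
Local Open Scope ring_scope.

Section Defs.
Context {R : realType}.

(* On Borel sets this is Lebesgue measure; on other sets, which are never
   needed, the iterated integral behind [\x] has no meaning. *)
Fixpoint lebesgue_tuple (n : nat) : set (n.-tuple R) -> \bar R :=
  match n with
  | 0 => \d_([tuple] : 0.-tuple R)
  | m.+1 => pushforward (lebesgue_measure \x @lebesgue_tuple m)%E
              (fun z : R * m.-tuple R => [tuple of z.1 :: z.2])
  end.

Definition volume (d : nat) (A : set 'rV[R]_d) : \bar R :=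
  lebesgue_tuple [set t : d.-tuple R | A (\row_i tnth t i)].

(* The norm `|x| of the library on 'rV[R]_d is the sup norm. *)
Definition enorm (d : nat) (x : 'rV[R]_d) : R :=
  Num.sqrt (\sum_i x ord0 i ^+ 2).

Definition cball (d : nat) (p : 'rV[R]_d) (r : R) : set 'rV[R]_d :=
  [set x | enorm (x - p) <= r].

Definition kappa (n : nat) : R := fine (volume (cball (0 : 'rV[R]_n) 1)).

Definition minkowski_sum (d : nat) (A B : set 'rV[R]_d) : set 'rV[R]_d :=
  [set x + y | x in A & y in B].

Definition conv_hull (d : nat) (A : set 'rV[R]_d) : set 'rV[R]_d :=
  smallest (@convex_set R 'rV[R]_d) A.

Definition steiner (d : nat) (K : set 'rV[R]_d) (V : nat -> R) : Prop :=
  (forall r : R, 0 <= r ->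
     volume (minkowski_sum K (cball 0 r)) =
     (\sum_(k < d.+1) kappa (d - k) * V k * r ^+ (d - k))%:E) /\
  (forall k : nat, (d < k)%N -> V k = 0).

(* For nonempty compact convex K exactly one sequence satisfies [steiner K]. *)
Definition intrinsic_volume (d : nat) (k : nat) (K : set 'rV[R]_d) : R :=
  xget (fun=> 0) [set V : nat -> R | steiner K V] k.

End Defs.

Arguments kappa R n : clear implicits.

(* The Landau notations look up this structure on their filter. *)
Canonical pinfty_filter_on (R : numFieldType) :=
  FilterType (pinfty_nbhs R) _.

(* Main.v *)
(* Let K be the convex hull, and for a set J of indices let the piece A_J(r)
   consist of the points y + v, where y is a convex combination of the p_j with
   j in J, |v| <= r, and J is exactly the set of indices maximizing <v, p_j>.
   Since v is the displacement from the nearest point y of K, the A_J(r)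
   partition K + B(0, r).  The linear map that fixes the direction of the face J
   and multiplies its orthogonal complement by r maps A_J(1) to A_J(r) (up to a
   translation), so vol A_J(r) = c_J r^m with m the dimension of that
   complement; summing over J gives Steiner's formula.
   If m = d, the points p_j with j in J coincide and A_J(r) lies in a ball B_j.
   Otherwise Pythagoras gives that A_J(r') lies in the union of the balls as
   soon as r'^2 + D^2 <= r^2, e.g. for r' = r - D^2/r, and the volume lost is at
   most c_J (r^m - r'^m) = O(r^(m-2)) = O(r^(d-3)) as m < d. *)
Require Import Defs.
From HB Require Import structures.
From mathcomp Require Import all_boot all_order all_algebra.
From mathcomp Require Import all_classical all_reals all_analysis.
From mathcomp Require Import measurable_realfun.
From mathcomp Require Import ring lra zify.
Import Order.TTheory GRing.Theory Num.Theory.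
Import numFieldNormedType.Exports.
Local Open Scope classical_set_scope.
Local Open Scope ring_scope.

Set Implicit Arguments.
Unset Strict Implicit.
Unset Printing Implicit Defensive.

(** * Lebesgue measure on tuples *)

(** [volume] is an iterated product of one-dimensional Lebesgue measures, so invariance under
    rotations is not evident, while the faces point in arbitrary directions. The way around this is
    that an invertible linear map multiplies all volumes by one constant. Similar maps share that
    constant, so the stretching of the complement of a face can be computed for a diagonal matrix,
    on a cube. The partition gives Steiner's formula with coefficients c_J that are known only as
    volumes of the A_J(1). This suffices, since c_J r^m is only compared with c_J r'^m, and the sum
    of the c_J r^m is the Steiner polynomial of whichever sequence defines the intrinsic volumes.
    Just the leading term must be identified: V_0(K) = 1 follows by enclosing K + B(0, r) between
    balls of radii r and r + O(1). The case m = d stands apart because shrinking those pieces to r'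
    would cost O(r^(d-2)), which exceeds the allowed error. *)

Section Tuple.
Context {R : realType}.
Local Notation TR := (measurableTypeR R).

Lemma measurable_tuple_cons n :
  measurable_fun setT (fun z : TR * n.-tuple R =>
    [tuple of z.1 :: z.2] : n.+1.-tuple R).
Proof. exact: (@measurable_cons _ _ _ R). Qed.

Lemma measurable_tuple_uncons n :
  measurable_fun setT
    (fun t : n.+1.-tuple R => (thead t, [tuple of behead t]) : TR * n.-tuple R).
Proof.
apply/measurable_fun_pairP; split; first exact: measurable_tnth.
exact: measurable_behead.
Qed.

(** The product [\x] is a measure only when its second factor is a bundled sigma-finite measure,
    whereas [lebesgue_tuple] is a bare recursive function. The existential carries such a bundle
    through the induction. *)
Lemma sigma_finite_lebesgue_tuple n :
  exists mu : {sigma_finite_measure set (n.-tuple R) -> \bar R},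
    mu = @lebesgue_tuple R n :> (set (n.-tuple R) -> \bar R).
Proof.
elim: n => [|n [mu muE]].
  by exists (\d_([tuple] : 0.-tuple R)).
pose P : {measure set (TR * n.-tuple R)%type -> \bar R} :=
  (lebesgue_measure \x mu)%E.
pose m := measure_function_pushforward__canonical__measure_function_Measure
  P (@measurable_tuple_cons n).
have sfm : sigma_finite setT m.
  have /sigma_finiteP[F [FT ndF Foo]] := sigma_finiteT (@lebesgue_measure R).
  have /sigma_finiteP[G [GT ndG Goo]] := sigma_finiteT mu.
  exists (fun i => [set t : n.+1.-tuple R |
      F i (thead t) /\ G i [tuple of behead t]]).
    apply/esym/seteqP; split => // t _.
    have [i _ Fi] : (\bigcup_i F i) (thead t) by rewrite -FT.
    have [j _ Gj] : (\bigcup_i G i) [tuple of behead t] by rewrite -GT.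
    exists (maxn i j) => //; split.
    - by move: Fi; exact/subsetPset/ndF/leq_maxl.
    - by move: Gj; exact/subsetPset/ndG/leq_maxr.
  move=> i; have [mF Fi] := Foo i; have [mG Gi] := Goo i; split.
    rewrite -[X in measurable X]setTI.
    exact: (@measurable_tuple_uncons n measurableT _ (measurableX mF mG)).
  rewrite /m /= /pushforward (_ : _ @^-1` _ = F i `*` G i); last first.
    apply/seteqP; split => -[x t] /=; rewrite theadE;
      rewrite (_ : [tuple of _] = t) //; exact/val_inj.
  by rewrite /P /= product_measure1E // lte_mul_pinfty // ge0_fin_numE.
pose H2 := isSFinite.Build _ _ _ _ (sfinite_measure_sigma_finite sfm).
pose H3 := isSigmaFinite.Build _ _ _ _ sfm.
pose m' := HB.pack_for {sigma_finite_measure set (n.+1.-tuple R) -> \bar R}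
   (Measure.sort m) H2 H3.
by exists m'; rewrite /= /m' /= /P /= muE.
Qed.

Let lebesgue_tuple0 n : @lebesgue_tuple R n set0 = 0%E.
Proof. by have [mu <-] := sigma_finite_lebesgue_tuple n; exact: measure0. Qed.

Let tuple_ge0 n A : (0 <= @lebesgue_tuple R n A)%E.
Proof. by have [mu <-] := sigma_finite_lebesgue_tuple n; exact: measure_ge0. Qed.

Let tuple_sigma_additive n : semi_sigma_additive (@lebesgue_tuple R n).
Proof.
have [mu <-] := sigma_finite_lebesgue_tuple n.
exact: measure_semi_sigma_additive.
Qed.

HB.instance Definition _ n := isMeasure.Build _ _ _ (@lebesgue_tuple R n)
  (@lebesgue_tuple0 n) (@tuple_ge0 n) (@tuple_sigma_additive n).

Let tuple_sigma_finite n : sigma_finite setT (@lebesgue_tuple R n).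
Proof.
have [mu <-] := sigma_finite_lebesgue_tuple n; exact: sigma_finiteT.
Qed.

HB.instance Definition _ n := Measure_isSigmaFinite.Build _ _ _
  (@lebesgue_tuple R n) (@tuple_sigma_finite n).

Lemma lebesgue_tupleS n (A : set (n.+1.-tuple R)) :
  lebesgue_tuple A =
  (\int[lebesgue_measure]_(x in [set: TR])
     lebesgue_tuple [set t : n.-tuple R | A [tuple of x :: t]])%E.
Proof.
apply: eq_integral => x _ /=; congr (lebesgue_tuple _).
by apply/seteqP; split => t /=; rewrite /xsection /= inE.
Qed.

Lemma lebesgue_measure_shift (a : R) (A : set R) : measurable A ->
  lebesgue_measure ((fun x => x + a) @^-1` A) = lebesgue_measure A.
Proof.
move=> mA.
have ms : measurable_fun setT (fun x : TR => (x + a : TR)).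
  by apply: (@measurable_funD _ TR R setT id (cst a)) => //; exact: measurable_id.
pose m : {measure set TR -> \bar R} :=
  measure_function_pushforward__canonical__measure_function_Measure
  (lebesgue_measure : {measure set TR -> \bar R}) ms.
rewrite -[LHS]/(m A).
apply/esym/lebesgue_measure_unique => //= _ [[b c]] _ <-.
rewrite /m /= /pushforward.
rewrite (_ : _ @^-1` _ = `]b - a, c - a]%classic).
  rewrite /= !lebesgue_measure_itv /= !lte_fin ltrD2r; case: ifP => // _.
  by rewrite -!EFinB; congr EFin; ring.
by apply/seteqP; split => x /=; rewrite !in_itv/=; lra.
Qed.

Lemma ge0_integral_shift (a : R) (f : TR -> \bar R) : measurable_fun setT f ->
  (forall x, 0 <= f x)%E ->
  (\int[lebesgue_measure]_(x in [set: TR]) f ((x : R) + a)%R =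
   \int[lebesgue_measure]_(x in [set: TR]) f x)%E.
Proof.
move=> mf f0.
have ms : measurable_fun setT (fun x : TR => (x + a : TR)).
  by apply: (@measurable_funD _ TR R setT id (cst a)) => //; exact: measurable_id.
rewrite -[LHS](@ge0_integral_pushforward _ _ _ _ _ _ ms lebesgue_measure setT f) //.
by apply: eq_measure_integral => //= A mA AS; exact/lebesgue_measure_shift.
Qed.

Definition tuple_add n (s t : n.-tuple R) : n.-tuple R :=
  [tuple tnth s i + tnth t i | i < n].

Lemma tuple_add_cons n (s : n.+1.-tuple R) (x : R) (t : n.-tuple R) :
  tuple_add s [tuple of x :: t] =
  [tuple of thead s + x :: tuple_add [tuple of behead s] t].
Proof.
apply: eq_from_tnth => i; rewrite tnth_mktuple.
case: (unliftP ord0 i) => [j ->|->]; last by rewrite !tnth0.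
by rewrite !tnthS tnth_mktuple [in LHS](tuple_eta s) tnthS.
Qed.

Lemma lebesgue_tuple_shift n (s : n.-tuple R) (A : set (n.-tuple R)) :
  measurable A -> lebesgue_tuple (tuple_add s @^-1` A) = lebesgue_tuple A.
Proof.
elim: n s A => [|n ih] s A mA.
  by congr (lebesgue_tuple _); apply/seteqP; split => t /=;
    rewrite [tuple_add _ _]tuple0 [t]tuple0.
rewrite !lebesgue_tupleS.
pose F (x : TR) := lebesgue_tuple [set t : n.-tuple R | A [tuple of x :: t]].
have mc (x : TR) : measurable [set t : n.-tuple R | A [tuple of x :: t]].
  rewrite -[X in measurable X]setTI.
  by apply: (@measurable_cons _ _ _ R (cst x) n id) => //; exact: measurable_id.
transitivity (\int[lebesgue_measure]_(x in [set: TR]) F ((x : R) + thead s)%R)%E.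
  apply: eq_integral => x _.
  rewrite -[RHS](ih [tuple of behead s]) //; congr (lebesgue_tuple _).
  by apply/seteqP; split => t; rewrite /preimage /mkset tuple_add_cons [_ + x]addrC.
apply: ge0_integral_shift => //.
rewrite /F.
have mA' : measurable ((fun z : TR * n.-tuple R => [tuple of z.1 :: z.2]) @^-1` A).
  by rewrite -[X in measurable X]setTI; exact: measurable_tuple_cons.
have := measurable_fun_xsection
  (@lebesgue_tuple R n : {sigma_finite_measure set (n.-tuple R) -> \bar R}) mA'.
apply: eq_measurable_fun => x _ /=; congr (lebesgue_tuple _).
by apply/seteqP; split => t; rewrite /xsection /= inE.
Qed.

End Tuple.

(** * Volume as a measure on row vectors *)

Section RowMeasurable.
Context {R : realType} (d : nat).
Local Notation rV := 'rV[R]_d.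

Definition row_of_tuple (t : d.-tuple R) : rV := \row_i tnth t i.

Definition tuple_of_row (v : rV) : d.-tuple R := [tuple v ord0 i | i < d].

Lemma row_of_tupleK : cancel row_of_tuple tuple_of_row.
Proof. by move=> t; apply: eq_from_tnth => i; rewrite tnth_mktuple mxE. Qed.

Lemma tuple_of_rowK : cancel tuple_of_row row_of_tuple.
Proof. by move=> v; apply/rowP => i; rewrite mxE tnth_mktuple. Qed.

(** The sigma-algebra is carried over from tuples, where [lebesgue_tuple] is a measure;
    [measurable_open] shows that it contains the open sets. *)
Definition row_measurable : set (set rV) :=
  [set A | measurable (row_of_tuple @^-1` A)].

Let row_measurable0 : row_measurable set0.
Proof. by rewrite /row_measurable /= preimage_set0; exact: measurable0. Qed.

Let row_measurableC A : row_measurable A -> row_measurable (~` A).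
Proof. by rewrite /row_measurable /= preimage_setC; exact: measurableC. Qed.

Let row_measurable_bigcup (F : (set rV)^nat) :
  (forall i, row_measurable (F i)) -> row_measurable (\bigcup_i F i).
Proof.
by move=> mF; rewrite /row_measurable /= preimage_bigcup; exact: bigcupT_measurable.
Qed.

HB.instance Definition _ := @isMeasurable.Build
  (measure_tuple_display default_measure_display) rV row_measurable
  row_measurable0 row_measurableC row_measurable_bigcup.

Lemma measurable_rVP {d'} {T : measurableType d'} (f : T -> rV) :
  (forall i, measurable_fun setT (fun x => f x ord0 i)) -> measurable_fun setT f.
Proof.
move=> mf _ A mA.
have mt : measurable_fun setT (tuple_of_row \o f).
  apply/measurable_fun_tnthP => i; rewrite (_ : _ \o _ = fun x => f x ord0 i) //.
  by apply/funext => x /=; rewrite tnth_mktuple.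
rewrite (_ : f @^-1` A = (tuple_of_row \o f) @^-1` (row_of_tuple @^-1` A)).
  exact: mt.
by apply/seteqP; split => x /=; rewrite tuple_of_rowK.
Qed.

Lemma measurable_coord (i : 'I_d) : measurable_fun setT (fun v : rV => v ord0 i).
Proof.
move=> _ B mB; rewrite setTI.
rewrite /measurable /= /row_measurable /=.
rewrite (_ : _ @^-1` _ = (fun t => tnth t i) @^-1` B); last first.
  by apply/seteqP; split => t /=; rewrite mxE.
by rewrite -[X in measurable X]setTI; exact: measurable_tnth.
Qed.

Lemma volume_tuple (A : set rV) : volume A = lebesgue_tuple (row_of_tuple @^-1` A).
Proof. by []. Qed.

Let volume0 : @volume R d set0 = 0%E.
Proof. by rewrite volume_tuple preimage_set0 measure0. Qed.

Let volume_ge0 A : (0 <= @volume R d A)%E.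
Proof. exact: measure_ge0. Qed.

Let volume_sigma_additive : semi_sigma_additive (@volume R d).
Proof.
move=> F mF tF mUF; rewrite volume_tuple preimage_bigcup.
apply: (@measure_semi_sigma_additive _ _ _ (@lebesgue_tuple R d)
  (fun i => row_of_tuple @^-1` F i)).
- by move=> n; exact: mF.
- apply/trivIsetP => /= i j _ _ ij; rewrite -preimage_setI.
  by move/trivIsetP : tF => /(_ _ _ _ _ ij) ->//; rewrite preimage_set0.
- by rewrite -preimage_bigcup; exact: mUF.
Qed.

HB.instance Definition _ := isMeasure.Build _ rV R (@volume R d)
  volume0 volume_ge0 volume_sigma_additive.

Let volume_sigma_finite : sigma_finite setT (@volume R d).
Proof.
have [F FT Foo] := sigma_finiteT (@lebesgue_tuple R d).
have E i : row_of_tuple @^-1` (tuple_of_row @^-1` F i) = F i.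
  by apply/seteqP; split => t /=; rewrite row_of_tupleK.
exists (fun i => tuple_of_row @^-1` F i).
  by rewrite -preimage_bigcup -FT preimage_setT.
move=> i; rewrite volume_tuple E; split; last exact: (Foo i).2.
by rewrite /measurable /= /row_measurable /= E; exact: (Foo i).1.
Qed.

HB.instance Definition _ := Measure_isSigmaFinite.Build _ _ _
  (@volume R d) volume_sigma_finite.

Lemma volume_shift (a : rV) (A : set rV) : measurable A ->
  volume ((fun x => x + a) @^-1` A) = volume A.
Proof.
move=> mA; rewrite !volume_tuple -(lebesgue_tuple_shift (tuple_of_row a) mA).
congr (lebesgue_tuple _); apply/seteqP; split => t /=;
  rewrite (_ : row_of_tuple t + a = row_of_tuple (tuple_add (tuple_of_row a) t)) //;
  by apply/rowP => i; rewrite !mxE !tnth_mktuple addrC.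
Qed.

Lemma volume_fubini (E : set (rV * rV)) : measurable E ->
  (\int[@volume R d]_x volume [set y | E (x, y)] =
   \int[@volume R d]_y volume [set x | E (x, y)])%E.
Proof.
move=> mE.
have := indic_fubini_tonelli (@volume R d) (@volume R d) mE.
rewrite indic_fubini_tonelli_FE // indic_fubini_tonelli_GE // => H.
transitivity (\int[@volume R d]_x (@volume R d \o xsection E) x)%E.
  by apply: eq_integral => x _ /=; rewrite /xsection; congr (volume _);
    apply/seteqP; split => y /=; rewrite inE.
rewrite H.
by apply: eq_integral => x _ /=; rewrite /ysection; congr (volume _);
    apply/seteqP; split => y /=; rewrite inE.
Qed.

End RowMeasurable.

(** * Affine maps: measurability and an exchange formula for volumes *)

Section RowMaps.
Context {R : realType}.

Lemma measurable_affine {d'} {T : measurableType d'} n m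
  (f : T -> 'rV[R]_n) (M : 'M[R]_(n, m)) (c : 'rV[R]_m) :
  measurable_fun setT f -> measurable_fun setT (fun x => f x *m M + c).
Proof.
move=> mf; apply: measurable_rVP => i.
rewrite (_ : (fun _ => _) =
    (fun x => (\sum_j f x ord0 j * M j i) + c ord0 i)); last first.
  by apply/funext => x; rewrite !mxE.
apply: measurable_funD => //.
apply: measurable_sum => j.
apply: measurable_funM => //.
exact: (measurableT_comp (measurable_coord j) mf).
Qed.

Lemma measurable_rowD {d'} {T : measurableType d'} n (f g : T -> 'rV[R]_n) :
  measurable_fun setT f -> measurable_fun setT g ->
  measurable_fun setT (fun x => f x + g x).
Proof.
move=> mf mg; apply: measurable_rVP => i.
rewrite (_ : (fun _ => _) = (fun x => f x ord0 i + g x ord0 i)); last first.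
  by apply/funext => x; rewrite !mxE.
apply: measurable_funD;
  [exact: (measurableT_comp (measurable_coord i) mf)|
   exact: (measurableT_comp (measurable_coord i) mg)].
Qed.

Lemma measurable_preimage_affine n m (M : 'M[R]_(n, m))
    (c : 'rV[R]_m) (A : set 'rV[R]_m) :
  measurable A -> measurable ((fun x : 'rV[R]_n => x *m M + c) @^-1` A).
Proof.
move=> mA; rewrite -[X in measurable X]setTI.
exact: (measurable_affine M c (@measurable_id _ _ setT) measurableT mA).
Qed.

Lemma measurable_preimage_mulmx n m (M : 'M[R]_(n, m)) (A : set 'rV[R]_m) :
  measurable A -> measurable ((fun x : 'rV[R]_n => x *m M) @^-1` A).
Proof.
move=> /(measurable_preimage_affine M 0); congr measurable.
by apply/seteqP; split => x /=; rewrite addr0.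
Qed.

(* Weil's proof of the uniqueness of Haar measure: integrate in both orders
   the set of pairs [(x, y)] with [x \in A] and [y - x M^-1 \in B]. *)
Lemma volume_mulmx_exchange d (M : 'M[R]_d) (A B : set 'rV[R]_d) :
  M \in unitmx -> measurable A -> measurable B ->
  (volume A * volume B =
   volume [set x | B (- (x *m invmx M))%R] * volume [set x | A (x *m M)])%E.
Proof.
move=> uM mA mB.
pose E : set ('rV[R]_d * 'rV[R]_d) := [set z | A z.1 /\ B (z.2 - z.1 *m invmx M)].
(* Translating each section of [E] at fixed y by y M turns [E] into [E']. The condition on B then
   involves x alone, and for fixed x the condition on A is a translate of y M being in A. *)
pose E' : set ('rV[R]_d * 'rV[R]_d) :=
  [set z | A (z.1 + z.2 *m M) /\ B (- (z.1 *m invmx M))].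
have mAM : measurable [set x | A (x *m M)] by exact: measurable_preimage_mulmx.
have mBM : measurable [set x | B (- (x *m invmx M))].
  rewrite (_ : [set x | _] = (fun x => x *m (- invmx M)) @^-1` B).
    exact: measurable_preimage_mulmx.
  by apply/seteqP; split => x /=; rewrite mulmxN.
have m1 : measurable_fun setT (@fst 'rV[R]_d 'rV[R]_d) by [].
have m2 : measurable_fun setT (@snd 'rV[R]_d 'rV[R]_d) by [].
have mE : measurable E.
  apply: measurableI; first by rewrite -[X in measurable X]setTI; exact: m1.
  rewrite -[X in measurable X]setTI.
  have := measurable_rowD m2 (measurable_affine (- invmx M) 0 m1).
  move=> /(_ measurableT _ mB); congr measurable; congr (_ `&` _).
  by apply/seteqP; split => z /=; rewrite addr0 mulmxN.
have mE' : measurable E'.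
  apply: measurableI.
    rewrite -[X in measurable X]setTI.
    have := measurable_rowD m1 (measurable_affine M 0 m2).
    move=> /(_ measurableT _ mA); congr measurable; congr (_ `&` _).
    by apply/seteqP; split => z /=; rewrite addr0.
  rewrite -[X in measurable X]setTI.
  exact: (m1 measurableT _ mBM).
have sec (C D : set 'rV[R]_d) : measurable C -> measurable D ->
  (\int[@volume R d]_x volume [set y : 'rV[R]_d | C x /\ D y] = volume C * volume D)%E.
  move=> mC mD.
  transitivity (\int[@volume R d]_x (volume D * (\1_C x)%:E))%E.
    apply: eq_integral => x _; rewrite indicE; case: (boolP (x \in C)) => xC.
      rewrite mule1; congr (volume _); apply/seteqP; split => y /=; first by case.
      by split => //; exact: set_mem.
    rewrite mule0 (_ : [set y | _] = set0) ?measure0 //.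
    by apply/seteqP; split => y //= -[Cx _]; case/negP: xC; exact: mem_set.
  rewrite ge0_integralZl //.
  - by rewrite integral_indic // setIT muleC.
  - exact/measurable_EFinP.
rewrite -sec // -sec //.
transitivity (\int[@volume R d]_x volume [set y | E (x, y)])%E.
  apply: eq_integral => x _.
  case: (pselect (A x)) => Ax; last first.
    by congr (volume _); apply/seteqP; split => y /= [].
  rewrite (_ : [set y | E _] = 
    (fun y => y - x *m invmx M) @^-1` [set y | A x /\ B y]); last first.
    by apply/seteqP; split => y /= [].
  rewrite volume_shift //.
  rewrite (_ : [set y | _] = B) //; by apply/seteqP; split => y /=; [case|].
rewrite volume_fubini //.
transitivity (\int[@volume R d]_y volume [set x | E' (x, y)])%E.
  apply: eq_integral => y _.
  rewrite -(@volume_shift _ _ (y *m M)).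
    congr (volume _); apply/seteqP; split => x; rewrite /E /E' /preimage /=;
      by rewrite mulmxDl mulmxK // opprD addrCA subrr addr0.
  have := measurable_ysection y mE; congr measurable.
  by apply/seteqP; split => x; rewrite /ysection /= inE.
rewrite -volume_fubini //.
apply: eq_integral => x _.
case: (pselect (B (- (x *m invmx M)))) => Bx; last first.
  by congr (volume _); apply/seteqP; split => y /= [].
transitivity (volume [set y | A (y *m M)]); last first.
  congr (volume _); apply/seteqP; split => y /=; by [split|case].
rewrite -(volume_shift (x *m invmx M) mAM); congr (volume _).
apply/seteqP; split => y; rewrite /E' /preimage /=;
  rewrite mulmxDl mulmxKV // [_ + x]addrC; by [case|split].
Qed.

End RowMaps.

(** * Volume under linear maps *)

Section Boxes.
Context {R : realType}.
Local Notation TR := (measurableTypeR R).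

Lemma lebesgue_tuple_box n (b : 'I_n -> R) : (forall i, 0 <= b i) ->
  lebesgue_tuple [set t : n.-tuple R | forall i, `|tnth t i| <= b i] =
  (\prod_i (2 * b i))%:E.
Proof.
elim: n b => [|n ih] b b0.
  rewrite big_ord0 /= diracE mem_set //; by case.
rewrite lebesgue_tupleS big_ord_recl EFinM.
rewrite -(ih (fun i => b (lift ord0 i))) //.
have -> : (2 * b ord0)%:E = lebesgue_measure `[- b ord0, b ord0]%classic.
  rewrite lebesgue_measure_itv /= lte_fin; case: ltP => h.
    by rewrite -EFinB; congr EFin; ring.
  by congr EFin; have := b0 ord0; lra.
have -> : lebesgue_measure `[- b ord0, b ord0]%classic = 
   (\int[lebesgue_measure]_(x in [set: TR]) (\1_(`[- b ord0, b ord0]%classic) x)%:E)%E.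
  by rewrite integral_indic // setIT.
rewrite muleC -ge0_integralZl //; last first.
  by apply/measurable_EFinP; exact: measurable_indic.
apply: eq_integral => x _.
rewrite indicE; case: (boolP (x \in _)) => xb.
  rewrite mule1; congr (lebesgue_tuple _).
  move/set_mem : xb; rewrite /= in_itv /= => xb.
  apply/seteqP; split => t /= H i.
    by have := H (lift ord0 i); rewrite tnthS.
  case: (unliftP ord0 i) => [j ->|->]; last by rewrite tnth0 ler_norml.
  by rewrite tnthS; exact: H.
rewrite mule0 (_ : [set t | _] = set0) ?measure0 //.
apply/seteqP; split => t //= /(_ ord0); rewrite tnth0 ler_norml => xb'.
by case/negP: xb; apply: mem_set; rewrite /= in_itv.
Qed.

Definition box d (b : 'I_d -> R) : set 'rV[R]_d :=
  [set x | forall i, `|x ord0 i| <= b i].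

Lemma volume_box d (b : 'I_d -> R) : (forall i, 0 <= b i) ->
  volume (box b) = (\prod_i (2 * b i))%:E.
Proof.
move=> b0; rewrite volume_tuple -(lebesgue_tuple_box b0); congr (lebesgue_tuple _).
by apply/seteqP; split => t H i; have := H i; rewrite /= ?mxE.
Qed.

Lemma measurable_box d (b : 'I_d -> R) : measurable (box b).
Proof.
rewrite (_ : box b = \bigcap_(i in [set: 'I_d])
  ((fun v => v ord0 i) @^-1` `[- b i, b i]%classic)).
  apply: fin_bigcap_measurable => // i _.
  by rewrite -[X in measurable X]setTI; exact: measurable_coord.
by apply/seteqP; split => x /= H i => [_|]; have := H i;
  rewrite /= in_itv /= ler_norml //; exact.
Qed.

Lemma volume_bounded_lty d (A : set 'rV[R]_d) (b : R) : measurable A ->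
  A `<=` box (fun=> b) -> (volume A < +oo)%E.
Proof.
move=> mA Ab.
apply: (@le_lt_trans _ _ (volume (box (fun _ : 'I_d => `|b|)))).
  apply: le_measure => //; rewrite ?inE //; first exact: measurable_box.
  by move=> x /Ab H i; apply: le_trans (H i) _; rewrite ler_norm.
by rewrite volume_box // ltry.
Qed.

(** With B a cube, the exchange formula reads vol B * vol A = vol B' * vol (A M^-1), so c = vol B /
    vol B'. Finiteness of vol B' comes from the entries of M; its positivity comes from the same
    formula with A = B. *)
Lemma volume_mulmx d (M : 'M[R]_d) : M \in unitmx ->
  exists2 c : R, 0 < c &
    forall A, measurable A ->
      volume ((fun x : 'rV[R]_d => x *m M) @^-1` A) = (c%:E * volume A)%E.
Proof.
move=> uM.
pose B := box (fun _ : 'I_d => 1 : R).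
have mB : measurable B by exact: measurable_box.
have vB : volume B = (\prod_(i < d) (2 * 1))%:E by rewrite volume_box.
pose B' := [set x : 'rV[R]_d | B (- (x *m invmx M))].
have mB' : measurable B'.
  rewrite (_ : B' = (fun x => x *m (- invmx M)) @^-1` B).
    exact: measurable_preimage_mulmx.
  by apply/seteqP; split => x; rewrite /B' /preimage /= mulmxN.
have vB'fin : (volume B' < +oo)%E.
  apply: (@volume_bounded_lty _ _ (\sum_i \sum_j `|M j i|)) => //.
  move=> x Bx i.
  have -> : x = (x *m invmx M) *m M by rewrite mulmxKV.
  rewrite mxE; apply: (le_trans (ler_norm_sum _ _ _)).
  apply: (@le_trans _ _ (\sum_j `|M j i|)).
    apply: ler_sum => j _; rewrite normrM ler_piMl //.
    by have := Bx j; rewrite mxE normrN.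
  rewrite [leRHS](bigD1 i) //= lerDl; apply: sumr_ge0 => k _; exact: sumr_ge0.
have vB'0 : (0 < volume B')%E.
  rewrite lt0e measure_ge0 andbT; apply/eqP => vB'0.
  have := volume_mulmx_exchange uM mB mB.
  rewrite -/B' vB'0 mul0e vB -EFinM => -[] /eqP.
  by rewrite -expr2 expf_eq0 /= prodf_seq_eq0 => /hasP[i _ /=]; rewrite mulr1 pnatr_eq0.
have [b vB'E] : exists b, volume B' = b%:E.
  by exists (fine (volume B')); rewrite fineK // ge0_fin_numE // ltW.
have b0 : 0 < b by rewrite -lte_fin -vB'E.
exists (\prod_(i < d) (2 * 1) / b) => [|A mA].
  by rewrite divr_gt0 // prodr_gt0 // => i _; lra.
have := volume_mulmx_exchange uM mA mB.
rewrite -/B' vB'E vB => /(congr1 (fun x => (b^-1%:E * x)%E)).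
rewrite [RHS]muleA -EFinM mulVf ?gt_eqF // mul1e => <-.
by rewrite [(volume A * _)%E]muleC muleA -EFinM mulrC.
Qed.

(* A Gaussian elimination [P = C E V] of an idempotent makes [P] similar to
   the partial identity [E], through [E V + (1 - E) C^-1]. *)
Lemma idempotent_pid_mx d (P : 'M[R]_d) : P *m P = P ->
  exists2 Q : 'M[R]_d, Q \in unitmx & Q *m P = pid_mx (\rank P) *m Q.
Proof.
move=> PP.
set E : 'M[R]_d := pid_mx (\rank P).
set C := col_ebase P; set V := row_ebase P.
have uC : C \in unitmx by exact: col_ebase_unit.
have uV : V \in unitmx by exact: row_ebase_unit.
have PE : P = C *m E *m V by rewrite mulmx_ebase.
have EE : E *m E = E by rewrite mul_pid_mx !minnn (minn_idPr (rank_leq_row P)).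
have EVCE : E *m V *m C *m E = E.
  have := PP; rewrite {1 2 3}PE => /(congr1 (fun X => invmx C *m X *m invmx V)).
  by rewrite !mulmxA mulVmx // !mul1mx !mulmxK.
pose Q := E *m V + (1%:M - E) *m invmx C.
have EVP : E *m V *m P = E *m V by rewrite PE !mulmxA EVCE.
have QP : Q *m P = E *m V.
  rewrite mulmxDl EVP PE -!mulmxA mulKmx // !mulmxA mulmxBl mul1mx EE subrr.
  by rewrite mul0mx addr0.
exists Q; last first.
  by rewrite QP /Q mulmxDr !mulmxA EE mulmxBr mulmx1 EE subrr mul0mx addr0.
rewrite -row_free_unit -kermx_eq0; apply/eqP/row_matrixP => i; rewrite row0.
set u := row i _.
have uQ : u *m Q = 0.
  by apply/sub_kermxP; exact: row_sub.
have uE : u *m E = 0.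
  have : u *m E *m V = 0 by rewrite -mulmxA -QP mulmxA uQ mul0mx.
  by move=> /(congr1 (fun X => X *m invmx V)); rewrite mulmxK // mul0mx.
move: uQ; rewrite /Q mulmxDr !mulmxA uE mul0mx add0r mulmxBr mulmx1 uE subr0.
by move=> /(congr1 (fun X => X *m C)); rewrite mulmxKV // mul0mx.
Qed.

(** For an idempotent P this fixes the kernel of P and multiplies its image by r. *)
Definition stretch d (P : 'M[R]_d) (r : R) : 'M[R]_d := 1%:M + (r - 1) *: P.

(** By [idempotent_pid_mx] the stretch is conjugate to a diagonal one. The volume factor of the
    conjugating Q cancels, and the factor of the diagonal matrix is read off from a cube, whose
    preimage is again a box. *)
Lemma volume_stretch d (P : 'M[R]_d) (r : R) (A : set 'rV[R]_d) :
  P *m P = P -> 0 < r -> measurable A ->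
  volume ((fun x : 'rV[R]_d => x *m stretch P r) @^-1` A) =
    ((r ^- \rank P)%:E * volume A)%E.
Proof.
move=> PP r0 mA.
have [Q uQ QP] := idempotent_pid_mx PP.
set E : 'M[R]_d := pid_mx (\rank P).
pose dv (i : 'I_d) : R := if (i < \rank P)%N then r else 1.
have dv0 i : 0 < dv i by rewrite /dv; case: ifP.
have sE : stretch E r = diag_mx (\row_i dv i).
  apply/matrixP => i j; rewrite !mxE /dv -val_eqE /=.
  case: eqP => [->|_] /=; last by rewrite mulr0n mulr0 addr0.
  by case: ifP => _; rewrite ?mulr1 ?mulr0 ?addr0 // addrC subrK.
have uD : stretch E r \in unitmx.
  rewrite sE unitmxE det_diag unitfE; apply/prodf_neq0 => i _.
  by rewrite mxE gt_eqF.
have QS : Q *m stretch P r = stretch E r *m Q.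
  by rewrite /stretch mulmxDr mulmxDl mulmx1 mul1mx -scalemxAr -scalemxAl QP.
have [q q0 qE] := volume_mulmx uQ.
have [c c0 cE] := volume_mulmx uD.
have cr : c = r ^- \rank P.
  have := cE _ (@measurable_box d (fun=> 1)).
  rewrite volume_box // (_ : _ @^-1` _ = box (fun i => (dv i)^-1)); last first.
    apply/seteqP; split => x H i; have := H i;
      by rewrite /preimage /box /= sE mul_mx_diag !mxE normrM (gtr0_norm (dv0 i))
        -ler_pdivlMr // mul1r.
  rewrite volume_box => [|i]; last by rewrite ltW // invr_gt0.
  rewrite -EFinM mulr1 big_split /= prodfV => -[].
  rewrite mulrC => /mulIf <- //; last by apply/prodf_neq0 => i _; rewrite pnatr_eq0.
  rewrite -big_mkcond /= -(big_ord_widen d (fun=> r) (rank_leq_row P)).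
  by rewrite prodr_const card_ord.
have mAS : measurable ((fun x : 'rV[R]_d => x *m stretch P r) @^-1` A).
  exact: measurable_preimage_mulmx.
have mAQ : measurable ((fun x : 'rV[R]_d => x *m Q) @^-1` A).
  exact: measurable_preimage_mulmx.
have := qE _ mAS; rewrite (_ : _ @^-1` _ =
    (fun x => x *m stretch E r) @^-1` ((fun x => x *m Q) @^-1` A)); last first.
  by apply/seteqP; split => x; rewrite /preimage /= -!mulmxA QS.
rewrite cE // qE // cr muleCA => /(congr1 (fun x => q^-1%:E * x)%E).
by rewrite !muleA -!EFinM mulVf ?gt_eqF // !mul1e mul1r => ->.
Qed.

End Boxes.

(** * Topology of row vectors *)

Section RowTopology.
Context {R : realType}.

Lemma continuous_row (T : topologicalType) d (f : T -> 'rV[R]_d) :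
  (forall i, continuous (fun x => f x ord0 i)) -> continuous f.
Proof.
move=> cf x; apply/cvg_ballP => e e0.
have : \forall y \near x, forall i, ball (f x ord0 i) e (f y ord0 i).
  apply: filter_forall => i.
  by have /cvg_ballP /(_ _ e0) := cf i x.
by apply: filterS => y H; split => // i j; rewrite (ord1 i).
Qed.

Lemma continuous_sumr (T : topologicalType) (I : Type) (r : seq I) (F : I -> T -> R) :
  (forall i, continuous (F i)) -> continuous (fun x => \sum_(i <- r) F i x).
Proof.
move=> cF; apply: (@continuous_big R^o I +%R 0 xpredT (@add_continuous R^o) T r F).
by move=> i _; exact: cF.
Qed.

Lemma continuous_mulmx m n (M : 'M[R]_(m, n)) :
  continuous (fun x : 'rV[R]_m => x *m M).
Proof.
apply: continuous_row => i.
rewrite (_ : (fun _ => _) = (fun x : 'rV[R]_m => \sum_j x ord0 j * M j i)); last first.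
  by apply/funext => x; rewrite mxE.
apply: continuous_sumr => j x.
exact: (cvgM (@coord_continuous R 1 m ord0 j x) (cvg_cst (M j i))).
Qed.

(** U is the union of the countably many cubes with rational centre and radius 1/(n+1) that it
    contains. A cube around x of this kind has all its points within 2/(n+1) of x. *)
Lemma measurable_open d (U : set 'rV[R]_d) : open U -> measurable U.
Proof.
move=> oU.
pose B (z : {ffun 'I_d -> rat} * nat) : set 'rV[R]_d :=
  [set x | forall i, `|x ord0 i - ratr (z.1 i)| <= z.2.+1%:R^-1].
have mB z : measurable (B z).
  pose c : 'rV[R]_d := \row_i ratr (z.1 i).
  rewrite (_ : B z = (fun x => x *m 1%:M + - c) @^-1` box (fun=> z.2.+1%:R^-1)).
    by apply: measurable_preimage_affine; exact: measurable_box.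
  by apply/seteqP; split => x H i; have := H i; rewrite /preimage /= mulmx1 !mxE.
rewrite (_ : U = \bigcup_z (if `[< B z `<=` U >] then B z else set0)).
  apply: countable_bigcupT_measurable; first exact: countableP.
  by by move=> z; case: ifP => _; [exact: mB|exact: measurable0].
apply/seteqP; split => [x Ux|x [z _]]; last by case: asboolP => [BU /BU|].
have /nbhs_ballP[e /= e0 eU] := open_nbhs_nbhs (conj oU Ux).
have [n ne] : exists n : nat, 2 * n.+1%:R^-1 < e.
  have e20 : 0 < e / 2 by rewrite divr_gt0.
  have [n _ /(_ n (leqnn n))] := near_infty_natSinv_lt (PosNum e20).
  by exists n; rewrite mulrC -ltr_pdivlMr.
have ex i : exists q : rat, `|x ord0 i - ratr q| <= n.+1%:R^-1.
  have n0 : x ord0 i < x ord0 i + n.+1%:R^-1 by rewrite ltrDl invr_gt0.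
  have [q] := rat_in_itvoo n0; rewrite in_itv /= => /andP[xq qx].
  by exists q; rewrite distrC ger0_norm ?subr_ge0 ?ltW // ltrBlDl.
have [q qx] := choice ex.
exists ([ffun i => q i], n) => //.
case: asboolP => [_ i|]; first by rewrite ffunE.
case=> y By; apply: eU; split => // i j; rewrite (ord1 i) /ball /=.
have := By j; rewrite /= ffunE => yq.
apply: le_lt_trans ne; rewrite -[x ord0 j](subrK (ratr (q j))) -addrA.
apply: (le_trans (ler_normD _ _)).
by rewrite mulr_natl mulr2n lerD // distrC.
Qed.

Lemma measurable_closed d (F : set 'rV[R]_d) : closed F -> measurable F.
Proof.
move=> cF; rewrite -(setCK F); apply: measurableC.
by apply: measurable_open; rewrite openC.
Qed.

Definition simplex N : set 'rV[R]_N :=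
  [set l | (forall i, 0 <= l ord0 i) /\ \sum_i l ord0 i = 1].

(** Coefficient vectors of the convex combinations over J. Compactness is proved here, since faces
    are linear images of these sets. *)
Definition subsimplex N (J : {set 'I_N}) : set 'rV[R]_N :=
  [set l | simplex l /\ forall i, i \notin J -> l ord0 i = 0].

Lemma compact_subsimplex N (J : {set 'I_N}) : compact (subsimplex J).
Proof.
apply: bounded_closed_compact.
  exists 1; split; first exact: num_real.
  move=> M M1 l [[l0 l1] _] /=; rewrite [leLHS]mx_normrE.
  apply: bigmax_le => [|[i j] _ /=]; first by rewrite ltW // (lt_trans _ M1).
  rewrite (ord1 i) ger0_norm // ltW // (le_lt_trans _ M1) // -l1.
  by rewrite (bigD1 j) //= lerDl sumr_ge0.
rewrite (_ : subsimplex J =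
   (\bigcap_(i in [set: 'I_N]) [set l : 'rV[R]_N | 0 <= l ord0 i]) `&`
   [set l | \sum_i l ord0 i = 1] `&`
   (\bigcap_(i in [set i | i \notin J]) [set l | l ord0 i = 0])); last first.
  apply/seteqP; split => l.
    by move=> [[l0 l1] lJ]; split; [split => // i _; exact: l0|move=> i; exact: lJ].
  by move=> [[l0 l1] lJ]; split; [split => // i; exact: l0|move=> i; exact: lJ].
apply: closedI; first apply: closedI.
- apply: closed_bigI => i _.
  apply: (@preimage_closed _ _ (fun l : 'rV[R]_N => l ord0 i) [set x | 0 <= x]).
    by move=> x _; exact: coord_continuous.
  exact: closed_ge.
- apply: (@preimage_closed _ _ (fun l : 'rV[R]_N => \sum_i l ord0 i) [set x | x = 1]).
    move=> x _; apply: continuous_sumr => j.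
    exact: coord_continuous.
  exact: closed_eq.
- apply: closed_bigI => i _.
  apply: (@preimage_closed _ _ (fun l : 'rV[R]_N => l ord0 i) [set x | x = 0]).
    by move=> x _; exact: coord_continuous.
  exact: closed_eq.
Qed.

End RowTopology.

(** * Decomposition of the parallel body *)

Section Dot.
Context {R : realType} (d : nat).
Implicit Types u v w x y : 'rV[R]_d.

Definition dot u v : R := \sum_i u ord0 i * v ord0 i.

Lemma dotC u v : dot u v = dot v u.
Proof. by apply: eq_bigr => i _; rewrite mulrC. Qed.

Lemma dotDr u v w : dot u (v + w) = dot u v + dot u w.
Proof. by rewrite -big_split; apply: eq_bigr => i _; rewrite mxE mulrDr. Qed.

Lemma dotZr a u v : dot u (a *: v) = a * dot u v.
Proof. by rewrite mulr_sumr; apply: eq_bigr => i _; rewrite mxE; ring. Qed.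

Lemma dotNr u v : dot u (- v) = - dot u v.
Proof. by rewrite -scaleN1r dotZr mulN1r. Qed.

Lemma dotBr u v w : dot u (v - w) = dot u v - dot u w.
Proof. by rewrite dotDr dotNr. Qed.

Lemma dotDl u v w : dot (u + v) w = dot u w + dot v w.
Proof. by rewrite ![dot _ w]dotC dotDr. Qed.

Lemma dotZl a u v : dot (a *: u) v = a * dot u v.
Proof. by rewrite ![dot _ v]dotC dotZr. Qed.

Lemma dotNl u v : dot (- u) v = - dot u v.
Proof. by rewrite ![dot _ v]dotC dotNr. Qed.

Lemma dotBl u v w : dot (u - v) w = dot u w - dot v w.
Proof. by rewrite dotDl dotNl. Qed.

Lemma dot_ge0 u : 0 <= dot u u.
Proof. by apply: sumr_ge0 => i _; rewrite -expr2 sqr_ge0. Qed.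

Lemma dot_eq0 u : dot u u = 0 -> u = 0.
Proof.
move=> /eqP; rewrite psumr_eq0; last by move=> i _; rewrite -expr2 sqr_ge0.
move=> /allP H; apply/rowP => i; rewrite mxE.
by have := H i (mem_index_enum i); rewrite /= mulf_eq0 orbb => /eqP.
Qed.

Lemma enormE u : enorm u = Num.sqrt (dot u u).
Proof. by congr Num.sqrt; apply: eq_bigr => i _; rewrite expr2. Qed.

Lemma enorm_le u r : 0 <= r -> (enorm u <= r) = (dot u u <= r ^+ 2).
Proof.
move=> r0; rewrite enormE -{1}(ger0_norm r0) -sqrtr_sqr ler_sqrt // sqr_ge0 //.
Qed.

Lemma enorm_ge0 u : 0 <= enorm u.
Proof. by rewrite enormE sqrtr_ge0. Qed.

Lemma dotE u v : dot u v = (u *m v^T) ord0 ord0.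
Proof. by rewrite mxE; apply: eq_bigr => i _; rewrite mxE. Qed.

Lemma dotpp u v : dot (u + v) (u + v) = dot u u + 2 * dot u v + dot v v.
Proof. by rewrite dotDl !dotDr (dotC v u); ring. Qed.

Lemma measurable_dot w : measurable_fun setT (fun v : 'rV[R]_d => dot v w).
Proof.
apply: measurable_sum => i; apply: measurable_funM; first exact: measurable_coord.
exact: measurable_cst.
Qed.

End Dot.

Lemma conv_rowE (R : realType) d (t : {i01 R}) (x y : 'rV[R]_d) :
  conv t (x : convex_lmodType 'rV[R]_d) y = t%:num *: x + (1 - t%:num) *: y.
Proof. by []. Qed.

(** * Faces, normal cones and the pieces of the parallel body *)

Section Hull.
Context {R : realType} (N d : nat) (p : 'I_N -> 'rV[R]_d).
Implicit Types (J : {set 'I_N}) (x y z v : 'rV[R]_d).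

Definition comb (l : 'rV[R]_N) : 'rV[R]_d := l *m \matrix_i p i.

Lemma combE l : comb l = \sum_i l ord0 i *: p i.
Proof.
rewrite /comb mulmx_sum_row; apply: eq_bigr => i _.
by rewrite rowK.
Qed.

Lemma dot_comb v l : dot v (comb l) = \sum_i l ord0 i * dot v (p i).
Proof.
rewrite combE (big_morph (dot v) (dotDr v) (_ : dot v 0 = 0)); last first.
  by rewrite -(scale0r 0) dotZr mul0r.
by apply: eq_bigr => i _; rewrite dotZr.
Qed.

Definition face J : set 'rV[R]_d := comb @` subsimplex J.

Lemma face_hull J : face J `<=` face [set: 'I_N].
Proof.
by move=> _ [l [sl lJ] <-]; exists l => //; split => // i; rewrite inE.
Qed.

Lemma pt_face J i : i \in J -> face J (p i).
Proof.
move=> iJ; exists (delta_mx ord0 i).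
  split; first split.
  - by move=> j; rewrite mxE ler0n.
  - rewrite (bigD1 i) //= mxE !eqxx big1 ?addr0 // => j ji.
    by rewrite mxE (negbTE ji) andbF.
  - move=> j jJ; rewrite mxE eqxx /=; case: eqP => // ji.
    by rewrite ji iJ in jJ.
by rewrite /comb -rowE rowK.
Qed.

Lemma face_closed J : closed (face J).
Proof.
apply: compact_closed; first exact: norm_hausdorff.
apply: continuous_compact; last exact: compact_subsimplex.
by apply: continuous_subspaceT; exact: continuous_mulmx.
Qed.

Lemma face_convex J : convex_set (face J : set (convex_lmodType 'rV[R]_d)).
Proof.
move=> x y t; rewrite !inE => -[l [[l0 l1] lJ] <-] [m [[m0 m1] mJ] <-].
exists (t%:num *: l + (1 - t%:num) *: m).
  have t0 : 0 <= t%:num by [].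
  have t1 : 0 <= 1 - t%:num by rewrite subr_ge0.
  split; first split.
  - by move=> i; rewrite !mxE addr_ge0 // mulr_ge0.
  - under eq_bigr do rewrite !mxE.
    by rewrite big_split -!mulr_sumr /= l1 m1 !mulr1 addrC subrK.
  - by move=> i iJ; rewrite !mxE lJ // mJ // !mulr0 addr0.
by rewrite /comb mulmxDl -!scalemxAl.
Qed.

(** Convexity speaks of two points only, hence an induction on the size of the support: one vertex
    is split off and the other weights are renormalised. Weight 1 is separate, because nothing is
    left to renormalise. *)
Lemma comb_convex (C : set 'rV[R]_d) l :
  convex_set (C : set (convex_lmodType 'rV[R]_d)) -> range p `<=` C ->
  simplex l -> C (comb l).
Proof.
move=> cC pC.
have [n] := ubnP #|[pred i | l ord0 i != 0]|.
elim: n l => // n ih l ln [l0 l1].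
have [i li] : exists i, l ord0 i != 0.
  apply: contrapT => /forallNP H; move/eqP: l1.
  rewrite big1 1?eq_sym ?oner_eq0 // => i _.
  by have /negP := H i; rewrite negbK => /eqP.
have li1 : l ord0 i <= 1 by rewrite -l1 (bigD1 i) //= lerDl sumr_ge0.
pose m : 'rV[R]_N := \row_j (if j == i then 0 else l ord0 j).
have lm : l = l ord0 i *: delta_mx ord0 i + m.
  apply/rowP => j; rewrite !mxE eqxx /=; case: eqP => [->|_].
    by rewrite mulr1 addr0.
  by rewrite mulr0 add0r.
have sm : \sum_j m ord0 j = 1 - l ord0 i.
  rewrite -l1 [in RHS](bigD1 i) //= addrC addrK (bigD1 i) //= mxE eqxx add0r.
  by apply: eq_bigr => j ji; rewrite mxE (negbTE ji).
have m0 j : 0 <= m ord0 j by rewrite mxE; case: ifP.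
have Cp : C (p i) by apply: pC; exists i.
have pE : comb (delta_mx ord0 i) = p i by rewrite /comb -rowE rowK.
case: (eqVneq (l ord0 i) 1) => [li1'|li1'].
  suff m00 : m = 0 by rewrite lm m00 addr0 li1' scale1r pE.
  apply/rowP => j; rewrite [RHS]mxE; move/eqP: sm; rewrite li1' subrr psumr_eq0 //.
  by move=> /allP /(_ j (mem_index_enum j)) /eqP.
have t0 : 0 < 1 - l ord0 i by rewrite subr_gt0 lt_neqAle li1'.
pose m' := (1 - l ord0 i)^-1 *: m.
have Cm : C (comb m').
  apply: ih.
  - rewrite -ltnS; apply: leq_trans ln; rewrite ltnS; apply: proper_card.
    apply/properP; split.
      apply/fintype.subsetP => j; rewrite !inE /m' /m !mxE; case: (j =P i) => _.
        by rewrite mulr0 eqxx.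
      by rewrite mulf_eq0 negb_or => /andP[].
    by exists i; rewrite !inE // /m' /m !mxE eqxx mulr0 eqxx.
  - split; first by move=> j; rewrite /m' mxE mulr_ge0 // invr_ge0 ltW.
    under eq_bigr do rewrite /m' mxE.
    by rewrite -mulr_sumr sm mulVf // gt_eqF.
pose t : {i01 R} := Itv01 (l0 i) li1.
have := cC (p i) (comb m') t (mem_set Cp) (mem_set Cm); rewrite inE.
rewrite (_ : comb l = conv t (p i : convex_lmodType _) (comb m')) //.
rewrite [in LHS]lm /comb mulmxDl -scalemxAl -[delta_mx _ _ *m _]/(comb _) pE.
by rewrite conv_rowE /m' /comb -scalemxAl scalerA mulfV ?scale1r // gt_eqF.
Qed.

Lemma conv_hullE : conv_hull (range p) = face [set: 'I_N].
Proof.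
apply/seteqP; split.
  apply: smallest_sub; first exact: face_convex.
  by move=> _ [i _ <-]; exact: pt_face.
move=> _ [l [sl _] <-] C [cC pC].
exact: comb_convex.
Qed.

(* For nonempty [J]: the relative interior of the normal cone of [face J], if
   [J] consists of the indices of all points on a face of the hull, and empty
   otherwise. *)
Definition cone J : set 'rV[R]_d :=
  [set v | forall i j, i \in J -> dot v (p j) <= dot v (p i) ?= iff (j \in J)].

Lemma face_neq0 J y : face J y -> exists i, i \in J.
Proof.
move=> [l [[l0 l1] lJ] _]; apply: contrapT => /forallNP H.
move/eqP: l1; rewrite big1 1?eq_sym ?oner_eq0 // => i _; apply: lJ.
exact/negP.
Qed.

Lemma cone_face J v y i : cone J v -> face J y -> i \in J -> dot v y = dot v (p i).
Proof.
move=> cv [l [[l0 l1] lJ] <-] iJ; rewrite dot_comb.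
rewrite -[RHS]mul1r -l1 mulr_suml; apply: eq_bigr => j _.
case: (boolP (j \in J)) => [jJ|/lJ ->]; last by rewrite !mul0r.
by have [_] := cv i j iJ; rewrite jJ => /eqP ->.
Qed.

Lemma cone_hull J v z i : cone J v -> face [set: 'I_N] z -> i \in J ->
  dot v z <= dot v (p i).
Proof.
move=> cv [l [[l0 l1] _] <-] iJ; rewrite dot_comb.
rewrite -[leRHS]mul1r -l1 mulr_suml; apply: ler_sum => j _.
by rewrite ler_wpM2l //; have [] := cv i j iJ.
Qed.

Lemma cone_face_hull J v y z : cone J v -> face J y -> face [set: 'I_N] z ->
  dot v (z - y) <= 0.
Proof.
move=> cv Fy Fz; have [i iJ] := face_neq0 Fy.
by rewrite dotBr subr_le0 (cone_face cv Fy iJ) (cone_hull cv).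
Qed.

Lemma cone_scale J v r : 0 < r -> cone J v -> cone J (r *: v).
Proof.
move=> r0 cv i j iJ; rewrite !dotZl; have [le eq] := cv i j iJ.
split; first by rewrite ler_pM2l.
by rewrite -eq; apply/eqP/eqP => [/mulfI -> //|->//]; rewrite gt_eqF.
Qed.

(** Each of v, v' is an outer normal of the hull at its own point; adding the two inequalities gives
    |y' - y|^2 <= 0. Then v = v' as well, and J is recovered as the set of maximizers. *)
Lemma face_cone_unique J J' y y' v v' :
  face J y -> cone J v -> face J' y' -> cone J' v' -> y + v = y' + v' ->
  y = y' /\ J = J'.
Proof.
move=> Fy cv Fy' cv' E.
have yy : y' - y = v - v'.
  by rewrite -[y'](addrK v') -E; apply/rowP => k; rewrite !mxE; ring.
have H1 := cone_face_hull cv Fy (face_hull Fy').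
have H2 := cone_face_hull cv' Fy' (face_hull Fy).
have y0 : y' - y = 0.
  apply: dot_eq0; apply/eqP; rewrite eq_le dot_ge0 andbT {1}yy dotBl.
  by move: H2; rewrite -opprB dotNr; lra.
have yE : y = y' by apply/esym/eqP; rewrite -subr_eq0 y0.
have vE : v = v' by move: yy; rewrite y0 => /esym/eqP; rewrite subr_eq0 => /eqP.
split=> //; subst y' v'.
have [i iJ] := face_neq0 Fy; have [j jJ'] := face_neq0 Fy'.
apply/setP => k; rewrite -(cv i k iJ).2 -(cv' j k jJ').2.
by rewrite -(cone_face cv Fy iJ) -(cone_face cv' Fy' jJ').
Qed.

Lemma nearest_point x : (0 < N)%N ->
  exists2 y, face [set: 'I_N] y &
    forall z, face [set: 'I_N] z -> dot (x - y) (z - y) <= 0.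
Proof.
move=> N0.
pose g (l : 'rV[R]_N) : R := dot (x - comb l) (x - comb l).
have S0 : @subsimplex R N [set: 'I_N] !=set0.
  by have [l sl _] := @pt_face [set: 'I_N] (Ordinal N0) (finset.in_setT _); exists l.
have cg : {within subsimplex [set: 'I_N], continuous g}.
  apply: continuous_subspaceT.
  apply: continuous_sumr => i.
  have c0 : continuous (fun l : 'rV[R]_N => comb l ord0 i).
    move=> l; apply: (@continuous_comp _ _ _ comb (fun y : 'rV[R]_d => y ord0 i)).
      exact: continuous_mulmx.
    exact: coord_continuous.
  have c1 : continuous (fun l : 'rV[R]_N => (x - comb l) ord0 i).
    rewrite (_ : (fun _ => _) = (fun l => x ord0 i - comb l ord0 i)); last first.
      by apply/funext => m; rewrite !mxE.
    by move=> l; exact: (cvgB (cvg_cst (x ord0 i)) (c0 l)).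
  by move=> l; exact: (cvgM (c1 l) (c1 l)).
have [l lS lmin] := compact_EVT_min S0 (@compact_subsimplex _ _ _) cg.
rewrite inE in lS.
exists (comb l); first by exists l.
move=> z Fz; set w := z - comb l; set v := x - comb l.
have key t : 0 <= t -> t <= 1 -> 2 * t * dot v w <= t ^+ 2 * dot w w.
  move=> t0 t1.
  have Fl : face [set: 'I_N] (comb l) by exists l.
  have := @face_convex [set: 'I_N] z (comb l) (Itv01 t0 t1) (mem_set Fz) (mem_set Fl).
  rewrite inE => -[m Sm mE].
  have := lmin m (mem_set Sm); rewrite /g mE.
  rewrite -/v (_ : x - _ = v - t *: w); last first.
    rewrite conv_rowE /= /v /w.
    by apply/rowP => k; rewrite !mxE; ring.
  by rewrite dotpp !(dotNr, dotNl) !dotZr !dotZl; lra.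
rewrite leNgt; apply/negP => vw.
have W := dot_ge0 w.
have Wv : 0 < dot w w + dot v w by lra.
(* With a = <v, w> > 0 and b = |w|^2, the value t = a / (a + b) lies in [0, 1] whichever of a, b is
   larger, and [key] at t would give 2 (a + b) <= b. *)
have t0 : 0 <= dot v w / (dot w w + dot v w) by rewrite divr_ge0 // ltW.
have t1 : dot v w / (dot w w + dot v w) <= 1 by rewrite ler_pdivrMr // mul1r lerDr.
have := key _ t0 t1.
clear t0 t1 key; set a := dot v w in vw Wv *; set b := dot w w in W Wv *.
have -> : 2 * (a / (b + a)) * a = (2 * a * (b + a)) * (a / (b + a) ^+ 2).
  by field; rewrite gt_eqF.
have -> : (a / (b + a)) ^+ 2 * b = (a * b) * (a / (b + a) ^+ 2).
  by field; rewrite gt_eqF.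
rewrite ler_pM2r ?divr_gt0 ?exprn_gt0 //; nra.
Qed.

(** With y the nearest point and v = x - y, no p_i exceeds <v, y>. Since y is a weighted mean of the
    p_i, its weights vanish wherever <v, p_i> is smaller, so J collects the indices with
    equality. *)
Lemma face_cone_cover x : (0 < N)%N ->
  exists J y v, [/\ face J y, cone J v & x = y + v].
Proof.
move=> N0; have [y Fy ymin] := nearest_point x N0.
set v := x - y in ymin.
exists [set i | dot v (p i) == dot v y]%SET, y, v.
have le i : dot v (p i) <= dot v y.
  by rewrite -subr_le0 -dotBr; apply: ymin; exact: pt_face.
split; last by rewrite /v addrC subrK.
  have [l [[l0 l1] lT] lE] := Fy; exists l => //; split => // i.
  rewrite inE => iy; apply: contraNeq iy => li.
  have : \sum_i l ord0 i * (dot v y - dot v (p i)) = 0.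
    under eq_bigr do rewrite mulrBr.
    by rewrite big_split /= sumrN -mulr_suml l1 mul1r -dot_comb lE subrr.
  move=> /eqP; rewrite psumr_eq0 => [|j _]; last by rewrite mulr_ge0 // subr_ge0.
  move=> /allP /(_ i (mem_index_enum i)) /=.
  by rewrite mulf_eq0 (negbTE li) /= subr_eq0 eq_sym.
move=> i j; rewrite !inE => /eqP iy; rewrite iy.
by split; first exact: le.
Qed.

Definition piece J r : set 'rV[R]_d :=
  [set x | exists y v, [/\ face J y, cone J v, enorm v <= r & x = y + v]].

(** The radius carries over because the displacement from the nearest point is the shortest: if y +
    b = z + v, then |b|^2 = |v|^2 + 2 <v, z - y> + |z - y|^2 and the cross term is nonnegative. *)
Lemma piece_cover r : (0 < N)%N ->
  minkowski_sum (face [set: 'I_N]) (cball 0 r) = \bigcup_J piece J r.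
Proof.
move=> N0; apply/seteqP; split; last first.
  move=> _ [J _ [y [v [Fy cv vr ->]]]]; exists y; first exact: face_hull Fy.
  by exists v => //; rewrite /cball /= subr0.
move=> _ [y Fy [b br <-]].
have [J [z [v [Fz cv E]]]] := face_cone_cover (y + b) N0.
exists J => //; exists z, v; split => //.
move: br; rewrite /cball /= subr0 => br.
have r0 : 0 <= r by apply: le_trans br; exact: enorm_ge0.
move: br; rewrite !enorm_le // => br.
apply: le_trans br.
have -> : b = v + (z - y).
  by apply/(addrI y); rewrite E; apply/rowP => k; rewrite !mxE; ring.
have H := cone_face_hull cv Fz Fy.
rewrite dotpp -opprB dotNr dotNl dotNr opprK.
by have := dot_ge0 (y - z); lra.
Qed.

Lemma piece_disjoint J J' r r' x : piece J r x -> piece J' r' x -> J = J'.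
Proof.
move=> [y [v [Fy cv _ ->]]] [y' [v' [Fy' cv' _ E]]].
by have [_] := face_cone_unique Fy cv Fy' cv' E.
Qed.

Lemma piece_mono J r r' : r <= r' -> piece J r `<=` piece J r'.
Proof.
move=> rr _ [y [v [Fy cv vr ->]]]; exists y, v; split => //.
exact: le_trans rr.
Qed.

Definition coord_bound (k : 'I_d) : R := \sum_i `|p i ord0 k|.

Lemma hull_coord y k : face [set: 'I_N] y -> `|y ord0 k| <= coord_bound k.
Proof.
move=> [l [[l0 l1] _] <-]; rewrite combE summxE.
apply: (le_trans (ler_norm_sum _ _ _)); apply: ler_sum => i _.
rewrite mxE normrM ler_piMl // ger0_norm //.
by rewrite -l1 (bigD1 i) //= lerDl sumr_ge0.
Qed.

(* An upper bound for the squared diameter of the hull. *)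
Definition diam2 : R := \sum_k (2 * coord_bound k) ^+ 2.

Lemma diam2_ge0 : 0 <= diam2.
Proof. by apply: sumr_ge0 => k _; rewrite sqr_ge0. Qed.

Lemma hull_diam2 y z : face [set: 'I_N] y -> face [set: 'I_N] z ->
  dot (y - z) (y - z) <= diam2.
Proof.
move=> Fy Fz; apply: ler_sum => k _; rewrite -expr2 -real_normK ?num_real //.
rewrite lerXn2r ?nnegrE ?mulr_ge0 ?sumr_ge0 // !mxE.
apply: (le_trans (ler_normB _ _)).
have := hull_coord k Fy; have := hull_coord k Fz; lra.
Qed.

(** Any i in J serves as the centre: v has the same product with y and p_i, so |y + v - p_i|^2 =
    |v|^2 + |y - p_i|^2. *)
Lemma piece_sub_balls J r r' : 0 <= r -> 0 <= r' -> r' ^+ 2 + diam2 <= r ^+ 2 ->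
  piece J r' `<=` \bigcup_i cball (p i) r.
Proof.
move=> r0 r'0 rr _ [y [v [Fy cv vr ->]]].
have [i iJ] := face_neq0 Fy; exists i => //.
rewrite /cball /= enorm_le // (_ : _ - _ = v + (y - p i)); last first.
  by apply/rowP => k; rewrite !mxE; ring.
rewrite dotpp dotBr (cone_face cv Fy iJ) subrr mulr0 addr0.
rewrite enorm_le // in vr; apply: le_trans rr; rewrite lerD //.
by apply: hull_diam2; [exact: face_hull Fy|exact: pt_face].
Qed.

Lemma piece_sub_balls_point J r : {in J &, forall i j, p i = p j} ->
  piece J r `<=` \bigcup_i cball (p i) r.
Proof.
move=> Jp _ [y [v [Fy cv vr ->]]].
have [i iJ] := face_neq0 Fy; exists i => //.
suff -> : y = p i by rewrite /cball /= addrC addKr.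
have [l [[l0 l1] lJ] <-] := Fy; rewrite combE -[RHS]scale1r -l1 scaler_suml.
apply: eq_bigr => j _; case: (boolP (j \in J)) => [jJ|/lJ ->].
  by rewrite (Jp j i).
by rewrite !scale0r.
Qed.

Lemma piece_coord J r x k : piece J r x -> 0 <= r ->
  `|x ord0 k| <= coord_bound k + r.
Proof.
move=> [y [v [Fy _ vr ->]]] r0; rewrite mxE; apply: (le_trans (ler_normD _ _)).
apply: lerD; first exact: hull_coord (face_hull Fy).
rewrite enorm_le // in vr.
rewrite -(@ler_pXn2r _ 2) ?nnegrE // real_normK ?num_real //.
apply: le_trans vr; rewrite /dot (bigD1 k) //= -expr2 lerDl.
by apply: sumr_ge0 => i _; rewrite -expr2 sqr_ge0.
Qed.

End Hull.

(** * Volumes of the pieces *)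

Section OrthogonalProjection.
Context {R : realType} (m d : nat) (D : 'M[R]_(m, d)).

(** The row space of D meets its orthogonal complement [kermx D^T] only in 0 because the scalar
    product is definite; P projects onto the latter along the former. *)
Lemma orthogonal_projection : exists P : 'M[R]_d,
  [/\ P *m P = P, D *m P = 0 &
      forall u : 'rV[R]_d, u *m D^T = 0 -> u *m P = u].
Proof.
pose W := kermx D^T.
have cap0 : (W :&: <<D>>)%MS = 0.
  apply/eqP/rowV0P => u; rewrite sub_capmx => /andP[/sub_kermxP uD].
  rewrite genmxE => /submxP[a ua]; apply: dot_eq0.
  by rewrite dotE {2}ua trmx_mul mulmxA uD mul0mx mxE.
exists (proj_mx W <<D>>%MS); split.
- by apply: proj_mx_id => //; rewrite -[X in (X <= _)%MS]mul1mx proj_mx_sub.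
- by apply: proj_mx_0 => //; rewrite genmxE.
- by move=> u uD; apply: proj_mx_id => //; apply/sub_kermxP.
Qed.

End OrthogonalProjection.

Section PieceVolume.
Context {R : realType} (N d : nat) (p : 'I_N -> 'rV[R]_d).
Implicit Types (J : {set 'I_N}).

Lemma measurable_cball0 d' (r : R) : measurable (cball (0 : 'rV[R]_d') r).
Proof.
case: (ltP r 0) => r0.
  rewrite (_ : cball _ _ = set0) //; apply/seteqP; split => // v.
  rewrite /cball /= => /(le_trans (enorm_ge0 _)); lra.
rewrite (_ : cball _ _ = (fun v => dot v v) @^-1` [set x | x <= r ^+ 2]); last first.
  by apply/seteqP; split => v; rewrite /cball /preimage /= subr0 enorm_le.
have mf : measurable_fun setT (fun v : 'rV[R]_d' => dot v v).
  by apply: measurable_sum => i; apply: measurable_funM; exact: measurable_coord.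
rewrite -[X in measurable X]setTI; apply: mf => //.
by rewrite (_ : [set x | _] = `]-oo, r ^+ 2]%classic).
Qed.

Lemma measurable_cone J : measurable (cone p J).
Proof.
rewrite (_ : cone p J = \bigcap_(i in [set i | i \in J]) \bigcap_(j in [set: 'I_N])
   [set v | dot v (p j) <= dot v (p i) ?= iff (j \in J)]); last first.
  by apply/seteqP; split => v H; [move=> i iJ j _; exact: H|move=> i j iJ; exact: H].
apply: fin_bigcap_measurable => // i _; apply: fin_bigcap_measurable => // j _.
(* The [?= iff] condition says that <v, p_j - p_i> is zero for j in J and strictly negative
   otherwise. *)
pose B : set R := if j \in J then [set 0] else `]-oo, 0[%classic.
rewrite (_ : [set v | _] = (fun v => dot v (p j - p i)) @^-1` B); last first.
  apply/seteqP; split => v; rewrite /preimage /B /= dotBr; case: (j \in J) => /=.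
  - by case=> _ /eqP ->; rewrite subrr.
  - by case=> le ne; rewrite in_itv /= subr_lt0 lt_neqAle ne le.
  - by move=> /eqP; rewrite subr_eq0 => /eqP ->; split; rewrite ?eqxx.
  - by rewrite in_itv /= subr_lt0 => lt; split; [exact: ltW|rewrite lt_eqF].
rewrite -[X in measurable X]setTI; apply: measurable_dot => //.
by rewrite /B; case: ifP.
Qed.

(* [P] projects onto the orthogonal complement of the direction of the face, so
   that [stretch P r] maps [piece p J 1] to [piece p J r], up to translation. *)
Lemma piece_split J i0 : i0 \in J -> exists P : 'M[R]_d,
  [/\ P *m P = P, \rank P = d -> {in J &, forall i j, p i = p j},
      forall y, face p J y -> (y - p i0) *m P = 0 &
      forall v, cone p J v -> v *m P = v].
Proof.
move=> i0J.
pose D : 'M[R]_(N, d) := \matrix_i (if i \in J then p i - p i0 else 0).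
have [P [PP DP DtP]] := orthogonal_projection D.
exists P; split => //.
- move=> rP.
  have uP : P \in unitmx by rewrite -row_free_unit /row_free rP.
  have P1 : P = 1%:M.
    by move: PP => /(congr1 (fun X => invmx P *m X)); rewrite mulKmx // mulVmx.
  have D0 : D = 0 by rewrite -[D]mulmx1 -P1.
  have pi0 i : i \in J -> p i = p i0.
    move=> iJ; apply/eqP; rewrite -subr_eq0; apply/eqP.
    by have := congr1 (row i) D0; rewrite rowK iJ row0.
  by move=> i j iJ jJ; rewrite !pi0.
- move=> y [l [[l0 l1] lJ] <-].
  rewrite (_ : _ - _ = l *m D) -?mulmxA ?DP ?mulmx0 //.
  rewrite combE mulmx_sum_row -[p i0]scale1r -l1 scaler_suml -sumrB.
  apply: eq_bigr => i _; rewrite rowK; case: ifPn => [_|/lJ ->].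
    by rewrite scalerBr.
  by rewrite !scale0r subrr.
- move=> v cv; apply: DtP; apply/rowP => i; rewrite !mxE.
  rewrite -[LHS]/(\sum_j _) (_ : \sum_j _ = dot v (row i D)); last first.
    by apply: eq_bigr => j _; rewrite !mxE.
  rewrite rowK; case: ifP => iJ.
    by rewrite dotBr; apply/eqP; rewrite subr_eq0 (cv _ i i0J).2.
  by rewrite -(scale0r 0) dotZr mul0r.
Qed.

(** A sum of two measurable sets need not be measurable. Here P recovers v = (x - p_i0) P and y = x
    - v as affine functions of x, so the piece is an intersection of two preimages. *)
Lemma measurable_piece J (r : R) : measurable (piece p J r).
Proof.
have [[i0 i0J]|/forallNP J0] := pselect (exists i, i \in J); last first.
  rewrite (_ : piece _ _ _ = set0) //; apply/seteqP; split => // x [y [v [Fy _ _ _]]].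
  by have [i iJ] := face_neq0 Fy; case: (J0 i).
have [P [PP _ PF PC]] := piece_split i0J.
rewrite (_ : piece p J r =
  ((fun x => x *m P - p i0 *m P) @^-1` (cone p J `&` cball 0 r)) `&`
  ((fun x => x *m (1%:M - P) + p i0 *m P) @^-1` face p J)); last first.
  apply/seteqP; split => x.
    move=> [y [v [Fy cv vr ->]]]; rewrite /preimage /=.
    have -> : (y + v) *m P - p i0 *m P = v.
      by rewrite mulmxDl (PC v) // addrAC -mulmxBl PF // add0r.
    have -> : (y + v) *m (1%:M - P) + p i0 *m P = y.
      rewrite mulmxBr mulmx1 mulmxDl (PC v) //.
      have := PF _ Fy; rewrite mulmxBl => /eqP; rewrite subr_eq0 => /eqP ->.
      by apply/rowP => k; rewrite !mxE; ring.
    by rewrite /cball /= subr0.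
  move=> [[cx rx] Fx]; exists (x *m (1%:M - P) + p i0 *m P), (x *m P - p i0 *m P).
  split => //; first by move: rx; rewrite /cball /= subr0.
  by rewrite mulmxBr mulmx1; apply/rowP => k; rewrite !mxE; ring.
apply: measurableI; apply: measurable_preimage_affine.
  by apply: measurableI; [exact: measurable_cone|exact: measurable_cball0].
by apply: measurable_closed; exact: face_closed.
Qed.

Lemma volume_piece_lty J (r : R) : 0 <= r -> (volume (piece p J r) < +oo)%E.
Proof.
move=> r0; apply: (@volume_bounded_lty _ _ _ (\sum_k coord_bound p k + r)).
  exact: measurable_piece.
move=> x /piece_coord xr k; apply: le_trans (xr k r0) _; rewrite lerD2r.
rewrite (bigD1 k) //= lerDl; apply: sumr_ge0 => j _.
by apply: sumr_ge0 => i _.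
Qed.

Lemma volume_piece J : exists (m : nat) (c : R),
  [/\ (m <= d)%N, 0 <= c, m = d -> {in J &, forall i j, p i = p j} &
      forall r, 0 <= r -> volume (piece p J r) = (c * r ^+ m)%:E].
Proof.
have [[i0 i0J]|/forallNP J0] := pselect (exists i, i \in J); last first.
  exists 0%N, 0; split => // [_ i j iJ|r r0]; first by case: (J0 i).
  rewrite mul0r (_ : piece _ _ _ = set0) ?measure0 //.
  apply/seteqP; split => // x [y [v [Fy _ _ _]]].
  by have [i iJ] := face_neq0 Fy; case: (J0 i).
have [P [PP Pd PF PC]] := piece_split i0J.
(* Once p_i0 is moved to the origin, P kills the face, so [stretch P r] keeps y - p_i0 and
   multiplies v by r. *)
pose Z r : set 'rV[R]_d := (fun x => x + p i0) @^-1` piece p J r.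
have volZ r : volume (Z r) = volume (piece p J r).
  by rewrite volume_shift //; exact: measurable_piece.
have mZ r : measurable (Z r).
  have := measurable_preimage_affine 1%:M (p i0) (measurable_piece J r).
  by congr measurable; apply/seteqP; split => x; rewrite /Z /preimage /= mulmx1.
have Sy r y : face p J y -> (y - p i0) *m stretch P r = y - p i0.
  by move=> Fy; rewrite mulmxDr mulmx1 -scalemxAr PF // scaler0 addr0.
have Sv r v : cone p J v -> v *m stretch P r = r *: v.
  by move=> cv; rewrite mulmxDr mulmx1 -scalemxAr PC // scalerBl scale1r addrC subrK.
have ZE r : 0 < r -> Z 1 = (fun x => x *m stretch P r) @^-1` Z r.
  move=> r0; apply/seteqP; split => x; rewrite /Z /preimage /=.
    move=> [y [v [Fy cv v1 E]]]; exists y, (r *: v); split => //.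
    - exact: cone_scale.
    - move: v1; rewrite (enorm_le _ ler01) (enorm_le _ (ltW r0)).
      rewrite dotZl dotZr expr1n => v1.
      by rewrite mulrA -expr2 ler_piMr ?sqr_ge0.
    - have -> : x = (y - p i0) + v.
        by rewrite -[x](addrK (p i0)) E; apply/rowP => k; rewrite !mxE; ring.
      rewrite mulmxDl Sy // Sv //; apply/rowP => k; rewrite !mxE; ring.
  move=> [y [v [Fy cv v1 E]]]; exists y, (r^-1 *: v).
  have r'0 : 0 < r^-1 by rewrite invr_gt0.
  split => //; first exact: cone_scale.
    move: v1; rewrite (enorm_le _ ler01) (enorm_le _ (ltW r0)) dotZl dotZr => v1.
    by rewrite mulrA -expr2 exprVn mulrC ler_pdivrMr ?exprn_gt0 // expr1n mul1r.
  have SS : stretch P r *m stretch P r^-1 = 1%:M.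
    rewrite /stretch mulmxDl mul1mx mulmxDr mulmx1 -scalemxAl -scalemxAr PP.
    rewrite -addrA scalerA -!scalerDl [X in X *: P](_ : _ = 0) ?scale0r ?addr0 //.
    by field; rewrite gt_eqF.
  have -> : x = (y - p i0) + r^-1 *: v.
    rewrite -[x]mulmx1 -SS mulmxA -[x *m _](addrK (p i0)) E.
    by rewrite -addrA [v - _]addrC addrA mulmxDl Sy // Sv.
  by apply/rowP => k; rewrite !mxE; ring.
pose c := fine (volume (piece p J 1)).
have cE : volume (piece p J 1) = c%:E.
  by rewrite fineK // ge0_fin_numE // volume_piece_lty.
have c0 : 0 <= c by rewrite -lee_fin -cE measure_ge0.
have pos r : 0 < r -> volume (piece p J r) = (c * r ^+ \rank P)%:E.
  move=> r0; have := volume_stretch PP r0 (mZ r).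
  rewrite -ZE // !volZ cE => E.
  have : volume (piece p J r) = ((r ^+ \rank P)%:E *
      ((r ^- \rank P)%:E * volume (piece p J r)))%E.
    by rewrite muleA -EFinM mulfV ?mul1e // expf_neq0 // gt_eqF.
  by rewrite -E -EFinM mulrC.
exists (\rank P), c; split => //; first exact: rank_leq_row.
move=> r; rewrite le_eqVlt => /orP[/eqP <-|]; last exact: pos.
(* Stretching says nothing at r = 0, which Steiner's formula includes. In rank 0 every v vanishes
   and the radii 0 and 1 give the same piece, in accordance with 0^0 = 1; in positive rank the
   volume is squeezed below that of arbitrarily small pieces. *)
have [P0|m0] := eqVneq (\rank P) 0%N.
  rewrite P0 expr0 mulr1 -cE; congr (volume _); apply/seteqP; split.
    exact: piece_mono.
  move=> _ [y [v [Fy cv _ ->]]]; exists y, v; split => //.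
  have : v = 0.
    rewrite -(PC v cv) (_ : P = 0) ?mulmx0 //.
    by apply/eqP; rewrite -mxrank_eq0 P0.
  by move=> ->; rewrite enorm_le // -(scale0r 0) dotZl mul0r expr0n.
rewrite expr0n (negbTE m0) mulr0; apply/eqP; rewrite eq_le measure_ge0 andbT.
apply/lee_addgt0Pr => e e0; rewrite add0e.
(* The bound t <= 1 reduces t^m to t, and c + 1 keeps the denominator positive when c = 0. *)
pose t := Num.min 1 (e / (c + 1)).
have t0 : 0 < t by rewrite lt_min ltr01 divr_gt0 // ltr_wpDl.
apply: (@le_trans _ _ (volume (piece p J t))).
  apply: le_measure; rewrite ?inE; try exact: measurable_piece.
  by apply: piece_mono; exact: ltW.
rewrite pos // lee_fin; apply: (@le_trans _ _ (c * t)).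
  rewrite ler_wpM2l // -(prednK (_ : 0 < \rank P)%N) ?lt0n // exprS.
  rewrite ler_piMr ?(ltW t0) //.
  by rewrite exprn_ile1 // ?(ltW t0) // ge_min lexx.
apply: (@le_trans _ _ ((c + 1) * t)); first by rewrite ler_wpM2r ?lerDl // (ltW t0).
by rewrite mulrC -ler_pdivlMr ?ltr_wpDl // ge_min lexx orbT.
Qed.

End PieceVolume.

(** * Steiner's formula *)

Section Kappa.
Context {R : realType}.

Lemma measurable_cball d (q : 'rV[R]_d) r : measurable (cball q r).
Proof.
have := measurable_preimage_affine 1%:M (- q) (@measurable_cball0 R d r).
congr measurable; apply/seteqP; split => x;
  by rewrite /preimage /cball /= mulmx1 subr0.
Qed.

Lemma cball_coord d (x : 'rV[R]_d) r i : enorm x <= r -> `|x ord0 i| <= r.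
Proof.
move=> xr; have r0 : 0 <= r by apply: le_trans xr; exact: enorm_ge0.
rewrite enorm_le // in xr.
rewrite -(@ler_pXn2r _ 2) ?nnegrE // real_normK ?num_real //.
apply: le_trans xr; rewrite /dot (bigD1 i) //= -expr2 lerDl.
by apply: sumr_ge0 => k _; rewrite -expr2 sqr_ge0.
Qed.

Lemma kappaE d : volume (cball (0 : 'rV[R]_d) 1) = (kappa R d)%:E.
Proof.
rewrite fineK // ge0_fin_numE //.
apply: (@volume_bounded_lty _ _ _ 1); first exact: measurable_cball.
by move=> x; rewrite /cball /= subr0 => x1 i; exact: cball_coord.
Qed.

(** The ball contains the cube of half side 1/(d+1), where d + 1 instead of d admits d = 0.
    Positivity allows Steiner coefficients to be divided by [kappa]. *)
Lemma kappa_gt0 d : 0 < kappa R d.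
Proof.
rewrite -lte_fin -kappaE.
have b0 : 0 < (d.+1%:R : R)^-1 by rewrite invr_gt0.
apply: (@lt_le_trans _ _ (volume (box (fun _ : 'I_d => (d.+1%:R : R)^-1)))).
  rewrite volume_box => [|i]; last exact: ltW.
  by rewrite lte_fin prodr_gt0 // => i _; rewrite mulr_gt0.
apply: le_measure; rewrite ?inE; [exact: measurable_box|exact: measurable_cball|].
move=> x xb; rewrite /cball /= subr0 enorm_le // expr1n.
apply: (@le_trans _ _ (\sum_(i < d) (d.+1%:R : R)^-1)).
  apply: ler_sum => i _; rewrite -expr2 -real_normK ?num_real //.
  apply: (@le_trans _ _ ((d.+1%:R : R)^-1 ^+ 2)).
    by rewrite ler_pXn2r ?nnegrE // ltW.
  by rewrite expr2 ler_piMr ?(ltW b0) // invf_le1 // ler1n.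
rewrite sumr_const card_ord -[_ *+ d]mulr_natl ler_pdivrMr // mul1r.
by rewrite ler_nat.
Qed.

Lemma volume_cball d (q : 'rV[R]_d) r : 0 < r ->
  volume (cball q r) = (kappa R d * r ^+ d)%:E.
Proof.
move=> r0.
have -> : cball q r = (fun x => x + - q) @^-1` cball 0 r.
  by apply/seteqP; split => x; rewrite /preimage /cball /= subr0.
rewrite volume_shift; last exact: measurable_cball.
have I1 : (1%:M : 'M[R]_d) *m 1%:M = 1%:M by rewrite mulmx1.
have := volume_stretch I1 r0 (@measurable_cball0 R d r).
rewrite mxrank1 (_ : _ @^-1` _ = cball 0 1); last first.
  apply/seteqP; split => x; rewrite /preimage /cball /= !subr0 /stretch
    mulmxDr -scalemxAr !mulmx1 scalerBl scale1r addrC subrK;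
    rewrite (enorm_le _ ler01) (enorm_le _ (ltW r0)) dotZl dotZr expr1n.
  - by rewrite mulrA -expr2 ger_pMr // exprn_gt0.
  - by move=> x1; rewrite mulrA -expr2 ler_piMr ?sqr_ge0.
rewrite kappaE => /(congr1 (fun x => (r ^+ d)%:E * x)%E).
by rewrite muleA -!EFinM mulfV ?mul1e ?expf_neq0 ?gt_eqF // mulrC.
Qed.

End Kappa.

Lemma horner0_ge0 (R : realType) (q : {poly R}) :
  (forall s, 0 < s -> 0 <= q.[s]) -> 0 <= q.[0].
Proof.
move=> q0; rewrite leNgt; apply/negP => qneg.
have /cvgr_lt /(_ _ qneg) := @continuous_horner R q 0.
move=> /nbhs_ballP[e /= e0 /(_ (e / 2))].
rewrite /ball /= sub0r normrN ger0_norm ?divr_ge0 ?ltW //.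
rewrite gtr_pMr // invf_lt1 // ltr1n => /(_ isT).
by rewrite ltNge q0 // divr_gt0.
Qed.

Section Steiner.
Context {R : realType} (N d : nat) (p : 'I_N -> 'rV[R]_d).
Hypothesis N0 : (0 < N)%N.
Local Notation K := (conv_hull (range p)).

Lemma trivIset_piece (rho : {set 'I_N} -> R) :
  trivIset setT (fun J => piece p J (rho J)).
Proof. by move=> J J' _ _ [x [xJ xJ']]; exact: piece_disjoint xJ xJ'. Qed.

Lemma volume_bigcup_piece (rho : {set 'I_N} -> R) :
  volume (\bigcup_J piece p J (rho J)) = (\sum_J volume (piece p J (rho J)))%E.
Proof.
rewrite measure_fin_bigcup //.
- rewrite [RHS]fsbig_seq ?index_enum_uniq //; apply: eq_fsbigl.
  by apply/seteqP; split => J //= _; rewrite mem_index_enum.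
- exact: finite_finset.
- exact: trivIset_piece.
- by move=> J _; exact: measurable_piece.
Qed.

Lemma steiner_exists (m : {set 'I_N} -> nat) (c : {set 'I_N} -> R) :
  (forall J, (m J <= d)%N) ->
  (forall J r, 0 <= r -> volume (piece p J r) = (c J * r ^+ m J)%:E) ->
  exists V, steiner K V.
Proof.
move=> md vE.
(* Collects the pieces of degree d - k; [inord] is faithful because d - m J <= d. *)
pose a (k : 'I_d.+1) : R := \sum_(J | inord (d - m J) == k) c J.
exists (fun k => if (k <= d)%N then a (inord k) / kappa R (d - k) else 0).
split; last by move=> k dk; rewrite leqNgt dk.
move=> r r0; rewrite conv_hullE piece_cover // (volume_bigcup_piece (fun=> r)).
under eq_bigr do rewrite vE //.
rewrite sumEFin; congr EFin.
rewrite (partition_big (fun J => inord (d - m J) : 'I_d.+1) xpredT) //=.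
apply: eq_bigr => k _; rewrite -ltnS ltn_ord inord_val.
rewrite mulrCA mulfV ?mulr1 ?gt_eqF ?kappa_gt0 // mulr_suml.
apply: eq_bigr => J /eqP Jk; congr (_ * r ^+ _).
by rewrite -Jk inordK ?ltnS ?leq_subr // subKn.
Qed.

(** A ball of radius r lies in K + B(0, r), which lies in a ball of radius r + 1 + S. With s = 1/r
    the volume is s^-d q(s), where q is the reversed Steiner polynomial; letting s tend to 0 pins
    q(0) between the two leading coefficients, both [kappa R d]. *)
Lemma steiner_leading (V : nat -> R) : steiner K V -> kappa R d * V 0%N = kappa R d.
Proof.
move=> [VE _].
pose S := diam2 p; have S0 : 0 <= S by exact: diam2_ge0.
pose a k := kappa R (d - k) * V k.
pose q : {poly R} := \poly_(k < d.+1) a k.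
pose i0 := Ordinal N0.
have qE s : 0 < s ->
    \sum_(k < d.+1) kappa R (d - k) * V k * s^-1 ^+ (d - k) = s ^- d * q.[s].
  move=> s0; rewrite horner_poly mulr_sumr; apply: eq_bigr => k _.
  rewrite /a mulrCA; congr (_ * _).
  have kd : (k <= d)%N by rewrite -ltnS.
  have -> : s ^- d = s^-1 ^+ (d - k) * s^-1 ^+ k by rewrite -exprD subnK // exprVn.
  by rewrite -mulrA -exprMn mulVf ?gt_eqF // expr1n mulr1.
have mU r : 0 <= r -> measurable (minkowski_sum K (cball 0 r)).
  move=> r0; rewrite conv_hullE piece_cover //; apply: fin_bigcup_measurable => //.
  by move=> J _; exact: measurable_piece.
have lo s : 0 < s -> 0 <= q.[s] - kappa R d.
  move=> s0; have s'0 : 0 < s^-1 by rewrite invr_gt0.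
  have : (volume (cball (p i0) s^-1) <= volume (minkowski_sum K (cball 0 s^-1)))%E.
    apply: le_measure; rewrite ?inE; [exact: measurable_cball|exact: (mU _ (ltW s'0))|].
    move=> x xp; exists (p i0).
      by rewrite conv_hullE; exact: pt_face.
    by exists (x - p i0); rewrite /cball /= ?subr0 // addrC subrK.
  rewrite volume_cball // VE ?(ltW s'0) // lee_fin qE // exprVn mulrC.
  by rewrite ler_pM2l ?invr_gt0 ?exprn_gt0 // subr_ge0.
have hi s : 0 < s -> 0 <= kappa R d * (1 + (1 + S) * s) ^+ d - q.[s].
  move=> s0; have s'0 : 0 < s^-1 by rewrite invr_gt0.
  have t0 : 0 < s^-1 + (1 + S) by rewrite addr_gt0 // ltr_wpDr.
  have : (volume (minkowski_sum K (cball 0 s^-1)) <=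
          volume (cball (p i0) (s^-1 + (1 + S))))%E.
    apply: le_measure; rewrite ?inE; [exact: (mU _ (ltW s'0))|exact: measurable_cball|].
    move: s'0 t0; set r := s^-1 => r0 t0.
    move=> _ [y Ky [v vr <-]]; rewrite conv_hullE in Ky.
    have := hull_diam2 Ky (pt_face p (finset.in_setT i0)).
    move: vr; rewrite /cball /= subr0 (enorm_le _ (ltW r0)) (enorm_le _ (ltW t0)).
    rewrite -/S (_ : y + v - p i0 = v + (y - p i0)); last first.
      by apply/rowP => k; rewrite !mxE; ring.
    set w := y - p i0 => vr wS.
    rewrite dotpp.
    (* In place of Cauchy-Schwarz: |v - r w|^2 >= 0 bounds 2 <v, w> by r (1 + S). This is why the
       outer radius has 1 + S, without a square root of S. *)
    have := dot_ge0 (v - r *: w).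
    rewrite dotpp !(dotNr, dotNl) !dotZr !dotZl => H.
    have vw : 2 * dot v w <= r + r * S.
      rewrite -(ler_pM2l r0).
      have : r * (r * dot w w) <= r * (r * S) by rewrite !ler_pM2l.
      by move: H vr; rewrite !expr2; lra.
    by move: vr; rewrite !expr2; nra.
  rewrite volume_cball // VE ?(ltW s'0) // lee_fin qE //.
  rewrite (_ : s^-1 + (1 + S) = s^-1 * (1 + (1 + S) * s)); last first.
    by field; rewrite gt_eqF.
  rewrite exprMn mulrCA exprVn ler_pM2l ?invr_gt0 ?exprn_gt0 // subr_ge0.
  done.
have q0 : q.[0] = a 0%N.
  by rewrite horner_coef0 coef_poly.
have H1 : 0 <= q.[0] - kappa R d.
  have := @horner0_ge0 R (q - (kappa R d)%:P).
  by rewrite !hornerE; apply => s /lo; rewrite !hornerE.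
have H2 : 0 <= kappa R d - q.[0].
  pose q2 : {poly R} := (kappa R d)%:P * (1 + (1 + S)%:P * 'X) ^+ d - q.
  have q2E s : q2.[s] = kappa R d * (1 + (1 + S) * s) ^+ d - q.[s].
    by rewrite /q2 !hornerE.
  have : 0 <= q2.[0] by apply: horner0_ge0 => s /hi; rewrite q2E.
  by rewrite q2E mulr0 addr0 expr1n mulr1.
by move: H1 H2; rewrite q0 /a subn0; lra.
Qed.

End Steiner.

(** * Asymptotics of the union of balls *)

Section Asymptotics.
Context {R : realType}.

(** The difference of powers factors as S / r times m terms, each at most r^(m-1). The bound is
    written r^d / r^3 so that d < 3 makes sense with natural exponents. *)
Lemma exprB_shrink (r S : R) (m d : nat) : 0 <= S -> 1 <= r -> S <= r -> (m < d)%N ->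
  r ^+ m - (r - S / r) ^+ m <= d%:R * S * (r ^+ d / r ^+ 3).
Proof.
move=> S0 r1 Sr md.
have r0 : 0 < r by apply: lt_le_trans r1.
have Sr0 : 0 <= S / r by rewrite divr_ge0 // ltW.
have r'0 : 0 <= r - S / r.
  by rewrite subr_ge0 ler_pdivrMr //; apply: le_trans Sr _; rewrite ler_peMl // ltW.
case: m md => [|m] md.
  rewrite !expr0 subrr; apply: mulr_ge0; first exact: mulr_ge0.
  by rewrite divr_ge0 // exprn_ge0 // ltW.
rewrite subrXX opprB addrC subrK.
apply: (@le_trans _ _ (S / r * (\sum_(i < m.+1) r ^+ m))).
  rewrite ler_wpM2l //; apply: ler_sum => i _.
  have im : (i <= m)%N by rewrite -ltnS.
  have -> : r ^+ m = r ^+ (m - i) * r ^+ i by rewrite -exprD subnK.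
  rewrite /= ler_wpM2l ?exprn_ge0 ?(ltW r0) //.
  by rewrite lerXn2r ?nnegrE ?(ltW r0) // gerBl.
rewrite sumr_const card_ord -[_ *+ _]mulr_natl.
rewrite (_ : S / r * _ = m.+1%:R * S * (r ^+ m.+2 / r ^+ 3)); last first.
  by rewrite !exprS; field; rewrite gt_eqF.
apply: ler_pM; first exact: mulr_ge0.
- by rewrite divr_ge0 // exprn_ge0 // ltW.
- by rewrite ler_wpM2r // ler_nat ltnW.
- by rewrite ler_pM2r ?invr_gt0 ?exprn_gt0 // ler_weXn2l.
Qed.

Lemma tail_bound (a : nat -> R) (d : nat) (r : R) : 1 <= r ->
  `|\sum_(3 <= k < d.+1) a k * r ^+ (d - k)| <=
  (\sum_(3 <= k < d.+1) `|a k|) * (r ^+ d / r ^+ 3).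
Proof.
move=> r1; have r0 : 0 < r by apply: lt_le_trans r1.
rewrite mulr_suml; apply: (le_trans (ler_norm_sum _ _ _)).
rewrite big_nat_cond [leRHS]big_nat_cond; apply: ler_sum => k /andP[/andP[k3 kd] _].
rewrite normrM ler_wpM2l // ger0_norm ?exprn_ge0 ?(ltW r0) //.
rewrite ler_pdivlMr ?exprn_gt0 // -exprD ler_weXn2l //; lia.
Qed.

(** For d = 1 the sum ends before k = 2, while truncated subtraction would turn r^(d-2) into 1;
    hence the case distinction. *)
Lemma first_terms (a : nat -> R) (d : nat) (r : R) : (1 <= d)%N ->
  \sum_(k < d.+1) a k * r ^+ (d - k) =
  a 0%N * r ^+ d + a 1%N * r ^+ (d - 1) +
  (if d == 1%N then 0 else a 2%N * r ^+ (d - 2)) +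
  \sum_(3 <= k < d.+1) a k * r ^+ (d - k).
Proof.
case: d => [//|[_|d _]] /=.
  by rewrite big_geq // !big_ord_recl big_ord0 /= subn0 !addr0.
rewrite -(big_mkord xpredT (fun k => a k * r ^+ (d.+2 - k))).
rewrite big_ltn // big_ltn // big_ltn // subn0 !addrA.
by [].
Qed.

End Asymptotics.

(** * Comparison of the union of balls with the parallel body *)

Section UnionOfBalls.
Context {R : realType} (N d : nat) (p : 'I_N -> 'rV[R]_d).
Hypothesis N0 : (0 < N)%N.
Local Notation K := (conv_hull (range p)).

Lemma volume_pieces : exists (m : {set 'I_N} -> nat) (c : {set 'I_N} -> R),
  forall J, [/\ (m J <= d)%N, 0 <= c J, m J = d -> {in J &, forall i j, p i = p j} &
    forall r, 0 <= r -> volume (piece p J r) = (c J * r ^+ m J)%:E].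
Proof.
have [m mP] := choice (volume_piece p); have [c cP] := choice mP.
by exists m, c.
Qed.

Lemma steiner_conv_hull : exists V, steiner K V.
Proof.
have [m [c mcP]] := volume_pieces.
by apply: (steiner_exists N0 (m := m) (c := c)) => J; have [] := mcP J.
Qed.

Lemma volume_union_balls (V : nat -> R) : steiner K V -> exists C : R,
  forall r, 1 + diam2 p <= r ->
  `|fine (volume (\bigcup_i cball (p i) r)) -
    \sum_(k < d.+1) kappa R (d - k) * V k * r ^+ (d - k)| <= C * (r ^+ d / r ^+ 3).
Proof.
move=> [VE _]; have [m [c mcP]] := volume_pieces.
have md J : (m J <= d)%N by have [] := mcP J.
have c0 J : 0 <= c J by have [] := mcP J.
have vE J r : 0 <= r -> volume (piece p J r) = (c J * r ^+ m J)%:E.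
  by have [_ _ _] := mcP J; exact.
pose S := diam2 p; have S0 : 0 <= S by exact: diam2_ge0.
(* The threshold 1 + S yields r >= 1, used to compare powers, and S <= r; together they make r'
   nonnegative. *)
exists (\sum_J c J * (d%:R * S)) => r rS.
have r1 : 1 <= r by rewrite (le_trans _ rS) // lerDl.
have Sr : S <= r by rewrite (le_trans _ rS) // lerDr.
have r0 : 0 < r by apply: lt_le_trans r1.
pose r' := r - S / r.
have r'0 : 0 <= r'.
  by rewrite subr_ge0 ler_pdivrMr //; apply: le_trans Sr _; rewrite ler_peMl // ltW.
have rr' : r' ^+ 2 + S <= r ^+ 2.
  have -> : r' ^+ 2 + S = r ^+ 2 - S * (1 - S / r ^+ 2).
    by rewrite /r'; field; rewrite gt_eqF.
  rewrite gerBl mulr_ge0 // subr_ge0 ler_pdivrMr ?exprn_gt0 // mul1r.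
  by apply: le_trans Sr _; rewrite expr2 ler_peMl // ltW.
have r'r : r' <= r by rewrite gerBl divr_ge0 // ltW.
pose rho J := if m J == d then r else r'.
have rho0 J : 0 <= rho J by rewrite /rho; case: ifP => // _; exact: ltW.
set U := \bigcup_i cball (p i) r.
have mU : measurable U.
  by apply: fin_bigcup_measurable => // i _; exact: measurable_cball.
have mK : measurable (\bigcup_J piece p J r).
  by apply: fin_bigcup_measurable => // J _; exact: measurable_piece.
have mrho : measurable (\bigcup_J piece p J (rho J)).
  by apply: fin_bigcup_measurable => // J _; exact: measurable_piece.
(* One volume in two forms, the Steiner polynomial of V and the sum over pieces, so the error can be
   estimated piece by piece. *)
have KE : volume (\bigcup_J piece p J r) =
    (\sum_(k < d.+1) kappa R (d - k) * V k * r ^+ (d - k))%:E.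
  by rewrite -VE ?(ltW r0) // conv_hullE piece_cover.
have KE' : volume (\bigcup_J piece p J r) = (\sum_J c J * r ^+ m J)%:E.
  rewrite (volume_bigcup_piece p (fun=> r)) -sumEFin; apply: eq_bigr => J _.
  exact/vE/ltW.
have UK : (volume U <= volume (\bigcup_J piece p J r))%E.
  apply: le_measure; rewrite ?inE // -piece_cover //.
  move=> x [i _ xi]; exists (p i); first exact: pt_face.
  by exists (x - p i); rewrite /cball /= ?subr0 // addrC subrK.
have rhoU : (volume (\bigcup_J piece p J (rho J)) <= volume U)%E.
  apply: le_measure; rewrite ?inE // => x [J _].
  rewrite /rho; case: eqP => [mJ|_]; last by apply: piece_sub_balls => //; exact: ltW.
  by apply: piece_sub_balls_point; have [_ _ H _] := mcP J; exact: H.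
have rhoE : volume (\bigcup_J piece p J (rho J)) = (\sum_J c J * rho J ^+ m J)%:E.
  rewrite volume_bigcup_piece -sumEFin; apply: eq_bigr => J _.
  exact/vE.
have [u uE] : exists u, volume U = u%:E.
  exists (fine (volume U)); rewrite fineK // ge0_fin_numE //.
  by apply: le_lt_trans UK _; rewrite KE ltry.
move: UK rhoU; rewrite rhoE uE KE' !lee_fin /= => UK rhoU.
have -> : \sum_(k < d.+1) kappa R (d - k) * V k * r ^+ (d - k) = \sum_J c J * r ^+ m J.
  by apply/EFin_inj; rewrite -KE -KE'.
rewrite ler0_norm ?subr_le0 // opprB.
apply: (@le_trans _ _ (\sum_J c J * r ^+ m J - \sum_J c J * rho J ^+ m J)).
  by rewrite lerD2l lerN2.
rewrite -sumrB mulr_suml; apply: ler_sum => J _.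
rewrite -mulrBr -mulrA ler_wpM2l //.
rewrite /rho; case: eqP => [_|/eqP mJ].
  rewrite subrr; apply: mulr_ge0; first exact: mulr_ge0.
  by rewrite divr_ge0 // exprn_ge0 // ltW.
by apply: exprB_shrink => //; rewrite ltn_neqAle mJ md.
Qed.

End UnionOfBalls.

Theorem corollary1 (R : realType) (N d : nat) (p : 'I_N -> 'rV[R]_d)
  (hN : (1 <= N)%N) (hd : (1 <= d)%N) :
  let K := conv_hull (range p) in
  (fun r : R => fine (volume (\bigcup_i cball (p i) r)) : R^o) =
  (fun r : R =>
     kappa R d * r ^+ d
     + kappa R (d - 1) * intrinsic_volume 1 K * r ^+ (d - 1)
     + (if d == 1%N then 0
        else kappa R (d - 2) * intrinsic_volume 2 K * r ^+ (d - 2)) : R^o)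
  +O_ (+oo_R) (fun r : R => r ^ (d%:Z - 3) : R^o).
Proof.
move=> K.
(* Existence of a Steiner sequence excludes the default value 0 of [xget] in [intrinsic_volume]. *)
have sK : steiner K (xget (fun=> 0) [set V : nat -> R | steiner K V]).
  by apply: xgetPex; exact: steiner_conv_hull.
set V := xget _ _ in sK.
have [C CP] := volume_union_balls hN sK.
have a0 := steiner_leading hN sK.
pose a k := kappa R (d - k) * V k.
pose B := `|C| + \sum_(3 <= k < d.+1) `|a k|.
have B0 : 0 <= B by rewrite addr_ge0 // sumr_ge0.
apply/eqaddOP; near=> k; near=> r.
have rS : 1 + diam2 p <= r by near: r; apply: nbhs_pinfty_ge; exact: num_real.
have r1 : 1 <= r by rewrite (le_trans _ rS) // lerDl diam2_ge0.
have r0 : 0 < r by apply: lt_le_trans r1.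
have rE : r ^ (d%:Z - 3) = r ^+ d / r ^+ 3.
  by rewrite expfzDr ?gt_eqF // exprnN.
have e0 : 0 <= r ^+ d / r ^+ 3 by rewrite divr_ge0 ?exprn_ge0 // ltW.
rewrite [`|r ^ _|]ger0_norm rE //.
apply: (@le_trans _ _ (B * (r ^+ d / r ^+ 3))); last first.
  by rewrite ler_wpM2r //; near: k; apply: nbhs_pinfty_ge; exact: num_real.
rewrite mulrDl.
apply: (@le_trans _ _ (C * (r ^+ d / r ^+ 3) +
  (\sum_(3 <= k < d.+1) `|a k|) * (r ^+ d / r ^+ 3))); last first.
  by rewrite lerD2r ler_wpM2r // ler_norm.
(* The error is the deviation from the full Steiner sum plus the tail of that sum from k = 3 on. *)
apply: le_trans (lerD (CP r rS) (tail_bound a d r1)).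
apply: le_trans (ler_normD _ _).
rewrite (first_terms a r hd) {1}/a subn0 a0.
rewrite le_eqVlt; apply/orP; left; apply/eqP; congr `|_|.
rewrite /intrinsic_volume -/V /a /=.
rewrite -[LHS]/(fine _ - _).
by rewrite [in RHS]opprD addrA subrK.
Unshelve. all: by end_near.
Qed.
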